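(* The following conditions are equivalent for a $^*$-algebra $A$. (i) $A$ is an algebraic Baer $^*$-algebra. (ii) $A$ can be decomposed as a direct sum $M\oplus B$ (of $^*$-algebras), where $M$ is $^*$-isomorphic to a finite direct sum of full complex matrix algebras of size at least $2\times 2$, while the summand $B$ is $^*$-isomorphic to the linear span of the characteristic functions of the clopen sets in a Stonean topological space $T$.
   Context: Rings and algebras are associative and not necessarily unital. A $^*$-algebra is a complex algebra $A$ with a map $^*:A\to A$ (involution) satisfying $(a^* )^*=a$, $(a+b)^*=a^*+b^*$, $(ab)^*=b^*a^*$, $(\lambda a)^*=\overline{\lambda}a^*$ for $a,b\in A$, $\lambda\in\mathbb{C}$. An algebra is algebraic if each of its elements generates a finite dimensional subalgebra. A projection is an element $e$ with $e=e^*=e^2$. For $S\subseteq A$, the right annihilator is $\mathrm{ann}_r(S)=\{y\in A\mid ay=0\ \forall a\in S\}$. A Baer $^*$-algebra is a $^*$-algebra $A$ such that for every non-empty $S\subseteq A$ there is a projection $f\in A$ with $\mathrm{ann}_r(S)=fA=\{fy\mid y\in A\}$ (such an algebra is automatically unital). The full complex matrix algebra $M_n(\mathbb{C})$ is equipped with conjugate transpose as involution. Direct sums of $^*$-algebras have coordinatewise operations and involution. A Stonean topological space is a compact Hausdorff space that is extremally disconnected, i.e. every open set has open closure. The linear span of characteristic functions of clopen (closed and open) subsets of $T$ is a $^*$-algebra of complex functions with pointwise operations and complex conjugation as involution. Either summand $M$ or $B$ may be $\{0\}$ (empty direct sum of matrix algebras, respectively empty $T$). *)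

(* Defs.v *)
From HB Require Import structures.
From mathcomp Require Import all_boot all_order all_algebra.
From mathcomp Require Import complex.
From mathcomp Require Import all_classical all_reals all_analysis.

Set Implicit Arguments.
Unset Strict Implicit.
Unset Printing Implicit Defensive.

Import Order.TTheory GRing.Theory Num.Theory.

Local Open Scope classical_set_scope.
Local Open Scope ring_scope.

Declare Scope star_scope.
Delimit Scope star_scope with star.
Reserved Notation "x ** y" (at level 40, left associativity).

(* MathComp's algebras are unital, so *-algebras are built directly on top of
   complex vector spaces, with a product that need not have a unit.  The zero
   algebra is allowed. *)
HB.mixin Record Lmodule_isStarAlgebra (R : realType) A
    of GRing.Lmodule R[i] A := {
  smul : A -> A -> A;
  star : A -> A;
  smulA : associative smul;
  smulDl : left_distributive smul +%R;
  smulDr : right_distributive smul +%R;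
  smulZl : forall (k : R[i]) (a b : A), smul (k *: a) b = k *: smul a b;
  smulZr : forall (k : R[i]) (a b : A), smul a (k *: b) = k *: smul a b;
  starK : involutive star;
  starD : {morph star : a b / a + b};
  starM : forall a b : A, star (smul a b) = smul (star b) (star a);
  starZ : forall (k : R[i]) (a : A), star (k *: a) = conjc k *: star a;
}.

#[short(type="starAlgType")]
HB.structure Definition StarAlgebra (R : realType) :=
  {A of GRing.Lmodule R[i] A & Lmodule_isStarAlgebra R A}.

Notation "x ** y" := (smul x y) : star_scope.
Local Open Scope star_scope.

Section StarAlgebraNotions.
Variables (R : realType) (A : starAlgType R).
Implicit Types (S : set A) (a x y e f : A).

Definition is_subalgebra S : Prop :=
  [/\ S 0,
      forall x y, S x -> S y -> S (x + y),
      forall (k : R[i]) x, S x -> S (k *: x) &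
      forall x y, S x -> S y -> S (x ** y)].

Definition generated_subalgebra a : set A :=
  [set y | forall S, is_subalgebra S -> S a -> S y].

Definition finite_dimensional S : Prop :=
  exists (n : nat) (v : 'I_n -> A),
    (forall i, S (v i)) /\
    (forall x, S x -> exists c : 'I_n -> R[i], x = \sum_(i < n) c i *: v i).

Definition algebraic : Prop :=
  forall a, finite_dimensional (generated_subalgebra a).

Definition projection e : Prop := e = star e /\ e = e ** e.

Definition ann_r S : set A := [set y | forall a, S a -> a ** y = 0].

Definition baer : Prop :=
  forall S, S !=set0 ->
    exists f, projection f /\ ann_r S = [set f ** y | y in [set: A]].

End StarAlgebraNotions.

Arguments algebraic {R} A.
Arguments baer {R} A.

Definition star_isomorphic (R : realType) (A B : starAlgType R) : Prop :=
  exists phi : {linear A -> B},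
    [/\ bijective phi,
        {morph phi : x y / x ** y} &
        {morph phi : x / star x}].

Section DirectSum.
Variables (R : realType) (A B : starAlgType R).
Implicit Types u v w : (A * B)%type.

Let dmul u v : A * B := (u.1 ** v.1, u.2 ** v.2).
Let dstar u : A * B := (star u.1, star u.2).

Let dmulA : associative dmul.
Proof. by move=> u v w; rewrite /dmul /= !smulA. Qed.
Let dmulDl : left_distributive dmul +%R.
Proof. by move=> u v w; rewrite /dmul /= !smulDl. Qed.
Let dmulDr : right_distributive dmul +%R.
Proof. by move=> u v w; rewrite /dmul /= !smulDr. Qed.
Let dmulZl (k : R[i]) u v : dmul (k *: u) v = k *: dmul u v.
Proof. by rewrite /dmul /= !smulZl. Qed.
Let dmulZr (k : R[i]) u v : dmul u (k *: v) = k *: dmul u v.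
Proof. by rewrite /dmul /= !smulZr. Qed.
Let dstarK : involutive dstar.
Proof. by case=> a b; rewrite /dstar /= !starK. Qed.
Let dstarD : {morph dstar : u v / u + v}.
Proof. by move=> u v; rewrite /dstar /= !starD. Qed.
Let dstarM u v : dstar (dmul u v) = dmul (dstar v) (dstar u).
Proof. by rewrite /dstar /dmul /= !starM. Qed.
Let dstarZ (k : R[i]) u : dstar (k *: u) = conjc k *: dstar u.
Proof. by rewrite /dstar /= !starZ. Qed.

HB.instance Definition _ := Lmodule_isStarAlgebra.Build R (A * B)%type
  dmulA dmulDl dmulDr dmulZl dmulZr dstarK dstarD dstarM dstarZ.

End DirectSum.

(* Elements are dependent functions; for k = 0 this is the zero algebra. *)
Definition dirsum (R : realType) (k : nat) (F : 'I_k -> starAlgType R) : Type :=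
  forall i, F i.

Section FiniteDirectSum.
Variables (R : realType) (k : nat) (F : 'I_k -> starAlgType R).
Local Notation D := (dirsum F).
Implicit Types u v w : D.

HB.instance Definition _ := gen_eqMixin D.
HB.instance Definition _ := gen_choiceMixin D.

Let dadd u v : D := fun i => u i + v i.
Let dzero : D := fun i => 0.
Let dopp u : D := fun i => - u i.
Let dscale (c : R[i]) u : D := fun i => c *: u i.
Let dmul u v : D := fun i => u i ** v i.
Let dstar u : D := fun i => star (u i).

Let daddA : associative dadd.
Proof. by move=> u v w; apply: functional_extensionality_dep => i; exact: addrA. Qed.
Let daddC : commutative dadd.
Proof. by move=> u v; apply: functional_extensionality_dep => i; exact: addrC. Qed.
Let dadd0 : left_id dzero dadd.
Proof. by move=> u; apply: functional_extensionality_dep => i; exact: add0r. Qed.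
Let daddN : left_inverse dzero dopp dadd.
Proof. by move=> u; apply: functional_extensionality_dep => i; exact: addNr. Qed.
HB.instance Definition _ := GRing.isZmodule.Build D daddA daddC dadd0 daddN.

Let dscaleA a b v : dscale a (dscale b v) = dscale (a * b) v.
Proof. by apply: functional_extensionality_dep => i; exact: scalerA. Qed.
Let dscale1 : left_id 1 dscale.
Proof. by move=> u; apply: functional_extensionality_dep => i; exact: scale1r. Qed.
Let dscaleDr : right_distributive dscale +%R.
Proof. by move=> a u v; apply: functional_extensionality_dep => i; exact: scalerDr. Qed.
Let dscaleDl v : {morph dscale^~ v : a b / a + b}.
Proof. by move=> a b; apply: functional_extensionality_dep => i; exact: scalerDl. Qed.
HB.instance Definition _ :=
  GRing.Zmodule_isLmodule.Build R[i] D dscaleA dscale1 dscaleDr dscaleDl.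

Let dmulA : associative dmul.
Proof. by move=> u v w; apply: functional_extensionality_dep => i; exact: smulA. Qed.
Let dmulDl : left_distributive dmul +%R.
Proof. by move=> u v w; apply: functional_extensionality_dep => i; exact: smulDl. Qed.
Let dmulDr : right_distributive dmul +%R.
Proof. by move=> u v w; apply: functional_extensionality_dep => i; exact: smulDr. Qed.
Let dmulZl (c : R[i]) u v : dmul (c *: u) v = c *: dmul u v.
Proof. by apply: functional_extensionality_dep => i; exact: smulZl. Qed.
Let dmulZr (c : R[i]) u v : dmul u (c *: v) = c *: dmul u v.
Proof. by apply: functional_extensionality_dep => i; exact: smulZr. Qed.
Let dstarK : involutive dstar.
Proof. by move=> u; apply: functional_extensionality_dep => i; exact: starK. Qed.
Let dstarD : {morph dstar : u v / u + v}.
Proof. by move=> u v; apply: functional_extensionality_dep => i; exact: starD. Qed.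
Let dstarM u v : dstar (dmul u v) = dmul (dstar v) (dstar u).
Proof. by apply: functional_extensionality_dep => i; exact: starM. Qed.
Let dstarZ (c : R[i]) u : dstar (c *: u) = conjc c *: dstar u.
Proof. by apply: functional_extensionality_dep => i; exact: starZ. Qed.

HB.instance Definition _ := Lmodule_isStarAlgebra.Build R D
  dmulA dmulDl dmulDr dmulZl dmulZr dstarK dstarD dstarM dstarZ.

End FiniteDirectSum.

Section MatrixAlgebra.
Variables (R : realType) (n : nat).
Local Notation M := 'M[R[i]]_n.

Let mstar (a : M) : M := (map_mx conjc a)^T.

Let mmulDl : left_distributive (@mulmx R[i] n n n) +%R.
Proof. by move=> a b c; exact: mulmxDl. Qed.
Let mmulDr : right_distributive (@mulmx R[i] n n n) +%R.
Proof. by move=> a b c; exact: mulmxDr. Qed.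
Let mmulA : associative (@mulmx R[i] n n n).
Proof. by move=> a b c; exact: mulmxA. Qed.
Let mmulZl (k : R[i]) (a b : M) : (k *: a) *m b = k *: (a *m b).
Proof. by rewrite scalemxAl. Qed.
Let mmulZr (k : R[i]) (a b : M) : a *m (k *: b) = k *: (a *m b).
Proof. by rewrite scalemxAr. Qed.
Let mstarK : involutive mstar.
Proof. by move=> a; apply/matrixP => i j; rewrite !mxE conjcK. Qed.
Let mstarD : {morph mstar : a b / a + b}.
Proof. by move=> a b; apply/matrixP => i j; rewrite !mxE rmorphD. Qed.
Let mstarM (a b : M) : mstar (a *m b) = mstar b *m mstar a.
Proof. by rewrite /mstar map_mxM trmx_mul. Qed.
Let mstarZ (k : R[i]) (a : M) : mstar (k *: a) = conjc k *: mstar a.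
Proof. by apply/matrixP => i j; rewrite !mxE rmorphM. Qed.

HB.instance Definition _ := Lmodule_isStarAlgebra.Build R M
  mmulA mmulDl mmulDr mmulZl mmulZr mstarK mstarD mstarM mstarZ.

End MatrixAlgebra.

Definition matrix_sum (R : realType) (k : nat) (n : 'I_k -> nat) :
    starAlgType R :=
  dirsum (fun i : 'I_k => 'M[R[i]]_(n i) : starAlgType R).

Definition stonean (T : topologicalType) : Prop :=
  [/\ compact [set: T],
      hausdorff_space T &
      forall U : set T, open U -> open (closure U)].

Section ClopenSpan.
Variables (R : realType) (T : topologicalType).
Local Notation C := R[i].

Definition in_clopen_span (g : T -> C) : Prop :=
  exists (n : nat) (c : 'I_n -> C) (U : 'I_n -> set T),
    (forall i, clopen (U i)) /\ g = \sum_(i < n) c i *: (\1_(U i) : T -> C).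

Definition clopen_span_pred : {pred T -> C} := fun g => `[< in_clopen_span g >].

Lemma clopen_spanE g : (g \in clopen_span_pred) = `[< in_clopen_span g >].
Proof. by []. Qed.

Lemma clopen_span0 : in_clopen_span 0.
Proof.
exists 0%N, (fun=> 0), (fun=> set0).
by split; [case | rewrite big_ord0].
Qed.

Lemma clopen_spanD g h :
  in_clopen_span g -> in_clopen_span h -> in_clopen_span (g + h).
Proof.
move=> [n [c [U [cU ->]]]] [m [d [V [cV ->]]]].
exists (n + m)%N,
  (fun i => match fintype.split i with inl j => c j | inr j => d j end),
  (fun i => match fintype.split i with inl j => U j | inr j => V j end).
split; first by move=> i; case: (fintype.split i).
rewrite big_split_ord /=; congr (_ + _); apply: eq_bigr => i _.
  by rewrite (unsplitK (inl i)).
by rewrite (unsplitK (inr i)).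
Qed.

Lemma clopen_spanZ (k : C) g : in_clopen_span g -> in_clopen_span (k *: g).
Proof.
move=> [n [c [U [cU ->]]]]; exists n, (fun i => k * c i), U; split => //.
by rewrite scaler_sumr; apply: eq_bigr => i _; rewrite scalerA.
Qed.

Lemma clopen_span_sum n (g : 'I_n -> T -> C) :
  (forall i, in_clopen_span (g i)) -> in_clopen_span (\sum_(i < n) g i).
Proof.
by move=> gS; elim/big_ind: _ => //; [exact: clopen_span0 | exact: clopen_spanD].
Qed.

Lemma clopen_span_indic (U : set T) : clopen U -> in_clopen_span (\1_U : T -> C).
Proof.
by move=> cU; exists 1%N, (fun=> 1), (fun=> U); rewrite big_ord1 scale1r.
Qed.

Lemma clopen_spanM g h :
  in_clopen_span g -> in_clopen_span h -> in_clopen_span (fun t => g t * h t).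
Proof.
move=> [n [c [U [cU ->]]]] [m [d [V [cV ->]]]].
have -> : (fun t => (\sum_(i < n) c i *: (\1_(U i) : T -> C)) t *
                    (\sum_(j < m) d j *: (\1_(V j) : T -> C)) t) =
    \sum_(i < n) \sum_(j < m) (c i * d j) *: (\1_(U i `&` V j) : T -> C).
  apply/funext => t; rewrite !fct_sumE big_distrlr /=; apply: eq_bigr => i _.
  rewrite fct_sumE; apply: eq_bigr => j _.
  by rewrite /GRing.scale /= indicI /= mulrACA.
apply: clopen_span_sum => i; apply: clopen_span_sum => j.
by apply/clopen_spanZ/clopen_span_indic/clopenI.
Qed.

Lemma clopen_span_conj g :
  in_clopen_span g -> in_clopen_span (fun t => conjc (g t)).
Proof.
move=> [n [c [U [cU ->]]]]; exists n, (fun i => conjc (c i)), U; split => //.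
apply/funext => t; rewrite !fct_sumE rmorph_sum; apply: eq_bigr => i _.
by rewrite /GRing.scale /= rmorphM /= indicE rmorph_nat.
Qed.

Lemma clopen_span_submod_closed : submod_closed clopen_span_pred.
Proof.
split; first by apply/asboolP; exact: clopen_span0.
move=> k g h /asboolP gS /asboolP hS; apply/asboolP.
by apply: clopen_spanD => //; exact: clopen_spanZ.
Qed.

HB.instance Definition _ :=
  GRing.isSubmodClosed.Build C (T -> C) clopen_span_pred
    clopen_span_submod_closed.

Record clopen_span : Type := ClopenSpan {
  clopen_span_fun :> T -> C;
  clopen_span_funP : clopen_span_fun \in clopen_span_pred }.

HB.instance Definition _ := [isSub for clopen_span_fun].
HB.instance Definition _ := gen_eqMixin clopen_span.
HB.instance Definition _ := gen_choiceMixin clopen_span.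
HB.instance Definition _ := [SubChoice_isSubLmodule of clopen_span by <:].

Implicit Types g h l : clopen_span.

Lemma clopen_spanP g : in_clopen_span g.
Proof. exact/asboolP/clopen_span_funP. Qed.

Lemma clopen_span_ext g h : (forall t, g t = h t) -> g = h.
Proof. by move=> gh; apply: val_inj; exact/funext. Qed.

Let cmul g h : clopen_span :=
  ClopenSpan (asboolT (clopen_spanM (clopen_spanP g) (clopen_spanP h))).
Let cstar g : clopen_span :=
  ClopenSpan (asboolT (clopen_span_conj (clopen_spanP g))).

Let cmulA : associative cmul.
Proof. by move=> g h l; apply: clopen_span_ext => t; exact: mulrA. Qed.
Let cmulDl : left_distributive cmul +%R.
Proof. by move=> g h l; apply: clopen_span_ext => t; exact: mulrDl. Qed.
Let cmulDr : right_distributive cmul +%R.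
Proof. by move=> g h l; apply: clopen_span_ext => t; exact: mulrDr. Qed.
Let cmulZl (k : C) g h : cmul (k *: g) h = k *: cmul g h.
Proof. by apply: clopen_span_ext => t; rewrite /= -mulrA. Qed.
Let cmulZr (k : C) g h : cmul g (k *: h) = k *: cmul g h.
Proof. by apply: clopen_span_ext => t; exact: mulrCA. Qed.
Let cstarK : involutive cstar.
Proof. by move=> g; apply: clopen_span_ext => t; exact: conjcK. Qed.
Let cstarD : {morph cstar : g h / g + h}.
Proof. by move=> g h; apply: clopen_span_ext => t; exact: rmorphD. Qed.
Let cstarM g h : cstar (cmul g h) = cmul (cstar h) (cstar g).
Proof.
by apply: clopen_span_ext => t /=; rewrite rmorphM mulrC.
Qed.
Let cstarZ (k : C) g : cstar (k *: g) = conjc k *: cstar g.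
Proof. by apply: clopen_span_ext => t; exact: rmorphM. Qed.

HB.instance Definition _ := Lmodule_isStarAlgebra.Build R clopen_span
  cmulA cmulDl cmulDr cmulZl cmulZr cstarK cstarD cstarM cstarZ.

End ClopenSpan.

(* Main.v *)
Require Import Defs.
From HB Require Import structures.
From mathcomp Require Import all_boot all_order all_algebra.
From mathcomp Require Import complex zify.
From mathcomp Require Import all_classical all_reals all_analysis.

(** Write C for the complex numbers.

    From the conditions to the decomposition.  Taking the annihilator of 0
    produces a unit, and a Baer involution is proper: x^* x = 0 forces x = 0
    ([baer_proper]).  In an algebraic algebra every element a satisfies a
    product of linear factors (a - c_1) ... (a - c_m) = 0 (the factors are
    recorded by the list of the c_i, see [roots_mul]), so the spectral theory
    is elementary: a nonzero self-adjoint element has a nonzero real eigenvalue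
    with an eigenprojection ([self_adjoint_eigenprojection]), and a nonzero
    element of square zero yields a partial isometry of square zero
    ([sqzero_partial_isometry]), i.e. a copy of the 2 x 2 matrix units.

    The heart of the proof is [no_orthogonal_sqzero]: there is no sequence of
    pairwise orthogonal corners which all contain a nonzero element of square
    zero.  Otherwise one places in the n-th corner two projections p_n, g_n
    with p_n g_n p_n = p_n / (1 + n^2); the Baer condition provides their joins
    e and s, and e s e then has infinitely many eigenvalues, so it is not
    algebraic.  Where no nonzero element has square zero the algebra is
    commutative ([reduced_commutative]).  So noncommutativity can only occur
    finitely often.

    Precisely, let f be the largest central projection with fA commutative
    ([abelian_summand]).  Below 1 - f every nonzero central projection has a
    noncommutative corner, hence 1 - f is a finite sum of minimal central
    projections h.  In each hA any two nonzero projections are linked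
    ([minimal_central_link]); an infinite orthogonal family of projections
    would by pairing give infinitely many orthogonal elements of square zero,
    so h is a finite sum of minimal projections, these are equivalent, and
    the equivalences are matrix units: hA is a full matrix algebra
    ([factor_quotient]).  The commutative part fA is described by the
    space of its characters: there are enough of them
    ([characters_separate]), every open set has an annihilator
    projection whose zero set is the closure ([closure_open_spectrum]), and this
    gives both that closures of open sets are open and that every clopen set is
    cut out by an element of the algebra.

    Conversely both properties pass through isomorphisms and finite sums.
    Matrices satisfy their characteristic polynomial and an annihilator is
    generated by a projection of maximal rank in it; a combination of clopen
    indicators has finitely many values, and an annihilator is generated by the
    indicator of the complement of the closure of the union of the supports.

    Summands of A are not built as algebras of their own.  For a central
    projection h they appear as surjective *-homomorphisms on A that vanish
    exactly where multiplication by h does ([star_quotient]). *)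

Set Implicit Arguments.
Unset Strict Implicit.
Unset Printing Implicit Defensive.

Import Order.TTheory GRing.Theory Num.Theory.

Local Open Scope classical_set_scope.
Local Open Scope ring_scope.
Local Open Scope star_scope.

(** * Products of linear factors acting on an algebra without unit *)

Section Calculus.
Variables (R : realType) (A : starAlgType R).
Implicit Types (a b x y : A) (c k : R[i]) (s : seq R[i]).

Lemma smul0l a : 0 ** a = 0.
Proof. by apply: (addrI (0 ** a)); rewrite -smulDl !addr0. Qed.
Lemma smul0r a : a ** 0 = 0.
Proof. by apply: (addrI (a ** 0)); rewrite -smulDr !addr0. Qed.
Lemma smulNl a b : (- a) ** b = - (a ** b).
Proof. by rewrite -scaleN1r smulZl scaleN1r. Qed.
Lemma smulNr a b : a ** (- b) = - (a ** b).
Proof. by rewrite -scaleN1r smulZr scaleN1r. Qed.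
Lemma smulBl a b x : (a - b) ** x = a ** x - b ** x.
Proof. by rewrite smulDl smulNl. Qed.
Lemma smulBr a b x : x ** (a - b) = x ** a - x ** b.
Proof. by rewrite smulDr smulNr. Qed.
Lemma smul_suml I (r : seq I) P (F : I -> A) x :
  (\sum_(i <- r | P i) F i) ** x = \sum_(i <- r | P i) F i ** x.
Proof. exact: (big_morph (fun y => y ** x) (fun y z => smulDl y z x) (smul0l x)). Qed.
Lemma smul_sumr I (r : seq I) P (F : I -> A) x :
  x ** (\sum_(i <- r | P i) F i) = \sum_(i <- r | P i) x ** F i.
Proof. exact: (big_morph (fun y => x ** y) (fun y z => smulDr x y z) (smul0r x)). Qed.
Lemma star0 : star 0 = 0 :> A.
Proof. by apply: (addrI (star 0)); rewrite -starD !addr0. Qed.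
Lemma starN a : star (- a) = - star a.
Proof. by rewrite -scaleN1r starZ rmorphN1 scaleN1r. Qed.
Lemma starB a b : star (a - b) = star a - star b.
Proof. by rewrite starD starN. Qed.
Lemma star_eq0 a : star a = 0 -> a = 0.
Proof. by move=> h; rewrite -(starK a) h star0. Qed.

(** The product of the factors a - c, for c in s, applied to b. Recording it
    through its action makes sense of the constant terms without a unit. *)
Definition roots_mul a s b := foldr (fun c y => a ** y - c *: y) b s.

Lemma roots_mul_cat a s1 s2 b :
  roots_mul a (s1 ++ s2) b = roots_mul a s1 (roots_mul a s2 b).
Proof. by rewrite /roots_mul foldr_cat. Qed.
Lemma roots_mulD a s b x : roots_mul a s (b + x) = roots_mul a s b + roots_mul a s x.
Proof.
elim: s => //= c s ->.
by rewrite smulDr scalerDr opprD addrACA.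
Qed.
Lemma roots_mulZ a s k b : roots_mul a s (k *: b) = k *: roots_mul a s b.
Proof.
elim: s => //= c s ->.
by rewrite smulZr scalerBr !scalerA mulrC.
Qed.
Lemma roots_mul0 a s : roots_mul a s 0 = 0.
Proof. by apply: (addrI (roots_mul a s 0)); rewrite -roots_mulD !addr0. Qed.
Lemma roots_mulB a s b x : roots_mul a s (b - x) = roots_mul a s b - roots_mul a s x.
Proof. by rewrite roots_mulD -scaleN1r roots_mulZ scaleN1r. Qed.
Lemma roots_mul_mulr a s b x : roots_mul a s (b ** x) = roots_mul a s b ** x.
Proof. by elim: s => //= c s ->; rewrite smulBl smulZl smulA. Qed.
Lemma roots_mul_comm a s b x : x ** a = a ** x ->
  roots_mul a s (x ** b) = x ** roots_mul a s b.
Proof. by move=> xa; elim: s => //= c s ->; rewrite smulBr smulZr !smulA xa. Qed.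
Lemma roots_mul_eigen a s y c : a ** y = c *: y ->
  roots_mul a s y = (\prod_(d <- s) (c - d)) *: y.
Proof.
move=> ay; elim: s => [|d s IH] /=; first by rewrite big_nil scale1r.
by rewrite IH smulZr ay big_cons !scalerA -scalerBl mulrC -mulrBl.
Qed.

(** Dropping factors one at a time, the last nonzero vector before the product
    vanishes is an eigenvector; this replaces minimal polynomials throughout. *)
Lemma roots_mul_factor a s b : b != 0 -> roots_mul a s b = 0 ->
  exists c s', [/\ c \in s, roots_mul a s' b != 0 &
                  a ** roots_mul a s' b = c *: roots_mul a s' b].
Proof.
move=> b0; elim: s => [/= b1|c s IH /=]; first by rewrite b1 eqxx in b0.
have [/IH[d [s' [ds y0 ay]]]|y0 /eqP] := eqVneq (roots_mul a s b) 0.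
  by exists d, s'; split => //; rewrite inE ds orbT.
by rewrite subr_eq0 => /eqP ay; exists c, s; rewrite inE eqxx.
Qed.

Lemma star_roots_mul a s b : star a = a -> b ** a = a ** b ->
  star (roots_mul a s b) = roots_mul a (map conjc s) (star b).
Proof.
move=> sa ba; elim: s => //= c s <-.
rewrite starB starZ; congr (_ - _).
by rewrite -(roots_mul_comm s b (erefl (a ** a))) -ba roots_mul_mulr starM sa.
Qed.

End Calculus.

(** The usable form of being algebraic: C is algebraically closed, so a
    polynomial relation splits, and an extra factor a makes it act as 0 on
    all elements and not only on a. *)
Definition split_algebraic (R : realType) (A : starAlgType R) :=
  forall a : A, exists s, forall b : A, roots_mul a s b = 0.

Section MatrixSplit.
Variable R : realType.

(** Cayley-Hamilton. *)
Lemma matrix_split_algebraic n : split_algebraic 'M[R[i]]_n.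
Proof.
case: n => [|n] a.
  by exists [::] => b; apply/matrixP => -[].
have [s es] := closed_field_poly_normal (char_poly a).
exists s => b.
suff -> : roots_mul a s b = horner_mx a (\prod_(z <- s) ('X - z%:P)) *m b.
  move: (Cayley_Hamilton a); rewrite es (monicP (char_poly_monic a)) scale1r => ->.
  by rewrite mul0mx.
elim: s {es} => [|c s IH] /=; first by rewrite big_nil rmorph1 mul1mx.
rewrite IH big_cons rmorphM rmorphB /= horner_mx_X horner_mx_C.
rewrite -mulmxE -mulmxA mulmxBl mul_scalar_mx; congr (_ - _).
Qed.

End MatrixSplit.

(** * Algebraic elements and products of linear factors *)

Section Algebraic.
Variables (R : realType) (A : starAlgType R).
Implicit Types (a b x y : A).

(** Left multiplication by a maps the finite dimensional subalgebra generated
    by a to itself; the roots of the characteristic polynomial of its matrix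
    in a spanning family annihilate a, and one more root 0 moves this from a
    to a b for arbitrary b. *)
Lemma algebraic_split : algebraic A -> split_algebraic A.
Proof.
move=> alg a; have [n [v [vS vgen]]] := alg a.
have aS : generated_subalgebra a a by move=> S _.
have MS j : generated_subalgebra a (a ** v j).
  by move=> S SS Sa; case: (SS) => _ _ _ SM; apply: SM => //; exact: vS.
have [M eM] : exists M : 'M[R[i]]_n, forall j, a ** v j = \sum_(i < n) M i j *: v i.
  have /choice[f ef] : forall j, exists c : 'I_n -> R[i],
    a ** v j = \sum_(i < n) c i *: v i by move=> j; exact: vgen (MS j).
  exists (\matrix_(i, j) f j i) => j.
  by rewrite ef; apply: eq_bigr => i _; rewrite mxE.
have [w ew] := vgen _ aS.
have [s ss] := matrix_split_algebraic M.
exists (s ++ [:: 0]) => b; rewrite roots_mul_cat /= scale0r subr0 roots_mul_mulr.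
suff -> : roots_mul a s a = 0 by rewrite smul0l.
case: n v vS vgen MS M eM w ew s ss => [|n] v vS vgen MS M eM w ew s ss.
  by rewrite big_ord0 in ew; rewrite ew roots_mul0.
(* [ev] reads the first column of B as coordinates, so left multiplication by
   M becomes left multiplication by a. *)
pose ev (B : 'M[R[i]]_n.+1) := \sum_(i < n.+1) B i ord0 *: v i.
have evs t B : ev (roots_mul M t B) = roots_mul a t (ev B).
  elim: t => //= c t <-; rewrite /ev smul_sumr scaler_sumr.
  under [X in _ = X - _]eq_bigr => i _ do rewrite smulZr eM scaler_sumr.
  rewrite exchange_big -sumrB; apply: eq_bigr => i _ /=.
  rewrite !mxE scalerDl; congr (_ + _); last by rewrite scaleNr scalerA.
  by rewrite scaler_suml; apply: eq_bigr => j _; rewrite scalerA mulrC.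
rewrite ew -[X in roots_mul _ _ X](_ : ev (\matrix_(i, j) w i) = _).
  by rewrite -ew -evs ss /ev big1 // => i _; rewrite mxE scale0r.
by apply: eq_bigr => i _; rewrite mxE.
Qed.

(** Expanding the product of m factors expresses the power m + 1 of a through
    the powers 1, ..., m, so these span the subalgebra generated by a. *)
Lemma split_algebraicW : split_algebraic A -> algebraic A.
Proof.
move=> salg a; have [s /(_ a) sa] := salg a.
pose pw i := iter i (smul a) a.
pose V n x := exists c : 'I_n -> R[i], x = \sum_(i < n) c i *: pw i.
have V0 n : V n 0.
  by exists (fun=> 0); rewrite big1 // => i _; rewrite scale0r.
have VD n x y : V n x -> V n y -> V n (x + y).
  move=> [c ->] [d ->]; exists (fun i => c i + d i).
  by rewrite -big_split /=; apply: eq_bigr => i _; rewrite scalerDl.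
have VZ n k x : V n x -> V n (k *: x).
  move=> [c ->]; exists (fun i => k * c i).
  by rewrite scaler_sumr; apply: eq_bigr => i _; rewrite scalerA.
have Vsum n m (c : 'I_m -> R[i]) (f : 'I_m -> A) : (forall i, V n (f i)) ->
    V n (\sum_(i < m) c i *: f i).
  move=> Vf; apply: (big_ind (V n)) => // [x y|i _]; first exact: VD.
  by apply: VZ.
have Vpw n i : (i < n)%N -> V n (pw i).
  move=> lin; exists (fun j => ((j : nat) == i)%:R).
  rewrite (bigD1 (Ordinal lin)) //= eqxx scale1r big1 ?addr0 // => j.
  by rewrite -val_eqE /= => /negbTE ->; rewrite scale0r.
have Va n x : V n x -> V n.+1 (a ** x).
  move=> [c ->]; rewrite smul_sumr.
  under eq_bigr => i _ do rewrite smulZr.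
  by apply: Vsum => i; apply: (Vpw n.+1 i.+1); rewrite ltnS.
have Vw n x : V n x -> V n.+1 x.
  by move=> [c ->]; apply: Vsum => i; apply: Vpw; rewrite ltnS ltnW.
have Vlead t : exists2 x, V (size t) x & roots_mul a t a = pw (size t) + x.
  elim: t => [|c t [x Vx e]] /=; first by exists 0; rewrite ?addr0.
  exists (a ** x - c *: (pw (size t) + x)).
    apply: (VD); first exact: Va.
    rewrite -scaleNr; apply: VZ; apply: VD; last exact: Vw.
    exact: Vpw.
  by rewrite e smulDr addrA.
set m := size s in Vlead.
have Vm : V m (pw m).
  have [x Vx e] := Vlead s; rewrite sa in e.
  have -> : pw m = (-1) *: x.
    by rewrite scaleN1r; apply/eqP; rewrite -addr_eq0 -e.
  exact: VZ.
have VMa x : V m x -> V m (a ** x).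
  move=> [c ->]; rewrite smul_sumr.
  under eq_bigr => i _ do rewrite smulZr.
  apply: Vsum => i; rewrite -[a ** _]/(pw i.+1).
  have := ltn_ord i; rewrite leq_eqVlt => /orP[/eqP ->//|]; exact: Vpw.
have VVa : V m a.
  case: (posnP m) => [m0|]; last exact: (Vpw m 0%N).
  by move: Vm; rewrite m0.
have pwM i x : V m x -> V m (pw i ** x).
  move=> Vx; elim: i => [|i IH] /=; first exact: VMa.
  by rewrite -smulA; exact: VMa.
have Vsub : is_subalgebra (V m).
  split => // [x y|k x|x y]; [exact: VD|exact: VZ|].
  move=> [c ->] Vy; rewrite smul_suml.
  by under eq_bigr => i _ do rewrite smulZl; apply: Vsum => i; exact: pwM.
exists m, (fun i => pw i); split; last by move=> x /(_ (V m) Vsub VVa).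
move=> i; elim: (nat_of_ord i) => [|j IH] S SS Sa //=.
by case: (SS) => _ _ _; apply => //; exact: IH.
Qed.

End Algebraic.

(** * Projections and the Baer condition *)

Section Projections.
Variables (R : realType) (A : starAlgType R).
Implicit Types (a b x y v w e f h p q : A).

Lemma projectionP e : projection e <-> star e = e /\ e ** e = e.
Proof. by split=> -[se ee]; split; apply: esym. Qed.

Definition central h := forall x, h ** x = x ** h.

Lemma unit_projection u : (forall x, u ** x = x) -> projection u ->
  forall x, x ** u = x.
Proof.
by move=> u1 /projectionP[su _] x; rewrite -(starK (x ** u)) starM su u1 starK.
Qed.

Lemma projection_le_sym e f : projection e -> projection f ->
  e ** f = e <-> f ** e = e.
Proof.
move=> /projectionP[se _] /projectionP[sf _].
by split=> ef; rewrite -{1}se -{1}sf -starM ef.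
Qed.

Lemma projection_orth_sym e f : projection e -> projection f ->
  e ** f = 0 -> f ** e = 0.
Proof.
by move=> /projectionP[se _] /projectionP[sf _] ef; rewrite -se -sf -starM ef star0.
Qed.

Lemma projection0 : projection (0 : A).
Proof. by apply/projectionP; rewrite star0 smul0l. Qed.

Lemma projectionB e f : projection e -> projection f -> e ** f = f ->
  projection (e - f).
Proof.
move=> pe pf ef; have fe := (projection_le_sym pf pe).2 ef.
case/projectionP: pe pf => se ee /projectionP[sf ff]; apply/projectionP.
by rewrite starB se sf !smulBl !smulBr ee ef fe ff subrr subr0.
Qed.

Lemma projectionD e f : projection e -> projection f -> e ** f = 0 ->
  projection (e + f).
Proof.
move=> pe pf ef; have fe := projection_orth_sym pe pf ef.
case/projectionP: pe pf => se ee /projectionP[sf ff]; apply/projectionP.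
by rewrite starD se sf !smulDl !smulDr ee ef fe ff addr0 add0r.
Qed.

End Projections.

Section BaerBasics.
Variables (R : realType) (A : starAlgType R).
Hypothesis bA : baer A.
Implicit Types (a b x y v w e f h p q : A) (S : set A).

(** Since f is idempotent, y lies in fA exactly when f y = y; this form of the
    Baer condition avoids naming preimages. *)
Lemma baer_ann S : S !=set0 -> exists f, [/\ projection f,
  forall a, S a -> a ** f = 0 &
  forall y, (forall a, S a -> a ** y = 0) -> f ** y = y].
Proof.
move=> /bA[f [pf ef]]; exists f; case/projectionP: (pf) => sf ff; split => //.
  suff : ann_r S f by [].
  by rewrite ef; exists f.
move=> y Sy; have : ann_r S y by [].
by rewrite ef => -[z _ <-]; rewrite smulA ff.
Qed.

(** Everything annihilates 0 on the right, so A = uA. *)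
Lemma baer_unit : exists2 u : A, projection u & forall x, u ** x = x.
Proof.
have [|u [pu _ u1]] := @baer_ann [set 0]; first by exists 0.
by exists u => // x; apply: u1 => a ->; rewrite smul0l.
Qed.

(** Let fA be the right annihilator of x^*. It contains x, so x = f x, while
    x^* f = 0 gives f x = 0. *)
Lemma baer_proper x : star x ** x = 0 -> x = 0.
Proof.
move=> xx; have [|f [/projectionP[sf _] fS f1]] := @baer_ann [set star x].
  by exists (star x).
have xf : star x ** f = 0 by exact: fS.
rewrite -(f1 x) => [|_ -> //].
by rewrite -(starK (f ** x)) starM sf xf star0.
Qed.

End BaerBasics.

(** * Eigenprojections and partial isometries *)

Section Spectral.
Variables (R : realType) (A : starAlgType R).
Hypothesis alg : split_algebraic A.
Hypothesis proper : forall x : A, star x ** x = 0 -> x = 0.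
Implicit Types (a b x y v w e f h p q : A).

(** Compare y^* (a y) with (a y)^* y, where y^* y is nonzero. *)
Lemma self_adjoint_eigenvalue_real a y c :
  star a = a -> y != 0 -> a ** y = c *: y -> conjc c = c.
Proof.
move=> sa y0 ay.
have yy0 : star y ** y != 0 by apply: contra_neq y0; exact: proper.
have : conjc c *: (star y ** y) = c *: (star y ** y).
  by rewrite -smulZl -starZ -ay starM sa -smulA ay smulZr.
move=> /eqP; rewrite -subr_eq0 -scalerBl scaler_eq0 (negbTE yy0) orbF.
by rewrite subr_eq0 => /eqP.
Qed.

(** For a nonreal c the element a - c is not a left zero divisor, so the factor
    can be cancelled. *)
Lemma self_adjoint_real_split a s b : star a = a -> roots_mul a s b = 0 ->
  roots_mul a [seq c <- s | conjc c == c] b = 0.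
Proof.
move=> sa; elim: s b => [//|c s IH] b ab.
have sw t : a ** roots_mul a t b - c *: roots_mul a t b = roots_mul a t (a ** b - c *: b).
  by rewrite roots_mulB roots_mulZ roots_mul_comm.
have /IH : roots_mul a s (a ** b - c *: b) = 0 by rewrite -sw.
rewrite -sw /= => ab0.
case: eqP => [//|cc] /=; apply/eqP/negPn/negP => y0; apply: cc.
by apply: (self_adjoint_eigenvalue_real sa y0); apply/eqP; rewrite -subr_eq0 ab0.
Qed.

(** An eigenvector y of the form p(a) a, p a product of factors, commutes with
    a and y^*; then y^* y is a scalar multiple of y and an idempotent up to a
    real scalar. *)
Lemma self_adjoint_eigenprojection a : star a = a -> a != 0 ->
  exists c e, [/\ c != 0, conjc c = c, projection e, e != 0 & a ** e = c *: e].
Proof.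
move=> sa a0; have [s sz] := alg a.
have [c [s' [_ y0 ay]]] := roots_mul_factor a0 (sz a).
set y := roots_mul a s' a in y0 ay.
have ys : star y = roots_mul a (map conjc s') a by rewrite star_roots_mul // sa.
have cr := self_adjoint_eigenvalue_real sa y0 ay.
have c0 : c != 0.
  apply: contra_neq y0 => c0; apply: proper; rewrite ys -roots_mul_mulr.
  by rewrite ay c0 scale0r roots_mul0.
have yy : star y ** y = (c * \prod_(d <- map conjc s') (c - d)) *: y.
  by rewrite ys -roots_mul_mulr ay roots_mulZ (roots_mul_eigen _ ay) scalerA.
set k := c * _ in yy; clearbody k.
set w := star y ** y in yy.
have w0 : w != 0 by apply: contra_neq y0; exact: proper.
have sw : star w = w by rewrite /w starM starK.
have aw : a ** w = c *: w by rewrite yy smulZr ay !scalerA mulrC.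
have [k' ww] : exists k', w ** w = k' *: w.
  exists (k * (c * \prod_(d <- s') (c - d))).
  rewrite {1}yy smulZl -scalerA; congr (_ *: _).
  by rewrite /y -roots_mul_mulr aw roots_mulZ (roots_mul_eigen _ aw) scalerA.
have k'0 : k' != 0.
  apply: contra_neq w0 => k0; apply: proper.
  by rewrite sw ww k0 scale0r.
have k'r : conjc k' = k'.
  have : star (w ** w) = w ** w by rewrite starM sw.
  rewrite ww starZ sw => /eqP.
  by rewrite -subr_eq0 -scalerBl scaler_eq0 (negbTE w0) orbF subr_eq0 => /eqP.
exists c, (k'^-1 *: w); split => //.
- apply/projectionP; rewrite starZ sw fmorphV /= k'r; split => //.
  by rewrite smulZl smulZr ww !scalerA -mulrA mulVf // mulr1.
- by rewrite scaler_eq0 negb_or invr_eq0 k'0.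
- by rewrite smulZr aw !scalerA mulrC.
Qed.

(** Take an eigenprojection e of x^* x for an eigenvalue c and normalise x e by
    a square root of c. The last two clauses keep v inside any corner that
    contains x. *)
Lemma sqzero_partial_isometry x : x ** x = 0 -> x != 0 ->
  exists v, [/\ v != 0, v ** v = 0, projection (star v ** v),
    forall e, e ** x = x -> e ** v = v & forall e, x ** e = x -> v ** e = v].
Proof.
move=> xx x0; set h := star x ** x.
have sh : star h = h by rewrite /h starM starK.
have h0 : h != 0 by apply: contra_neq x0; exact: proper.
have [c [e [c0 cr /projectionP[se ee] e0 he]]] := self_adjoint_eigenprojection sh h0.
have eh : e ** h = c *: e by rewrite -{1}se -{1}sh -starM he starZ se cr.
have ex : e ** x = 0.
  have : c *: (e ** x) = 0 by rewrite -smulZl -eh /h -!smulA xx !smul0r.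
  by move=> /eqP; rewrite scaler_eq0 (negbTE c0) => /eqP.
have [k kk] : exists k : R[i], k ^+ 2 = c by exists (sqrtc c); exact: sqr_sqrtc.
have k0 : k != 0 by apply: contra_neq c0 => k0; rewrite -kk k0 expr0n.
pose v := k^-1 *: (x ** e).
have vv : star v ** v = ((conjc k * k)^-1 * c) *: e.
  rewrite /v starZ smulZl smulZr starM se scalerA fmorphV /= invfM -(scalerA _ c).
  congr (_ *: _).
  by rewrite -!smulA (smulA (star x)) he smulZr ee.
have ev : e ** v = 0 by rewrite smulZr smulA ex smul0l scaler0.
(* c is real, so k is real or purely imaginary, according to its sign *)
have /orP[/eqP ck|/eqP ck] : (conjc k == k) || (conjc k == - k).
  by rewrite -eqf_sqr -rmorphXn /= kk cr.
- have vve : star v ** v = e by rewrite vv ck -expr2 kk mulVf // scale1r.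
  exists v; rewrite vve; split => //.
  + by apply: contra_neq e0 => v0; rewrite -vve v0 smul0r.
  + by rewrite /v smulZl -smulA -/v ev smul0r scaler0.
  + by move=> f fx; rewrite /v smulZr smulA fx.
  + move=> f xf; rewrite /v smulZl -smulA.
    suff -> : e ** f = e by [].
    apply: (scalerI c0).
    by rewrite -smulZl -eh /h -!smulA xf.
- have vve : star v ** v = - e.
    by rewrite vv ck mulNr -expr2 kk invrN mulNr mulVf // scaleN1r.
  (* c negative: v^* v = - e, and then (e + v)^* (e + v) = 0 *)
  have : e + v = 0.
    apply: proper; rewrite starD se !smulDl !smulDr ee ev vve addr0 addrCA.
    by rewrite subrr addr0 -se -starM ev star0.
  move=> /(congr1 (smul e)); rewrite smulDr ee ev smul0r addr0 => e1.
  by rewrite e1 eqxx in e0.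
Qed.

Lemma partial_isometry_mulr v : projection (star v ** v) -> v ** (star v ** v) = v.
Proof.
move=> /projectionP[sq qq]; set q := star v ** v in sq qq *.
have e : star v ** (v ** q - v) = 0 by rewrite smulBr smulA -/q qq subrr.
apply/eqP; rewrite -subr_eq0; apply/eqP; apply: proper.
by rewrite starB starM sq smulBl -smulA e smul0r subrr.
Qed.

Lemma partial_isometry_mull v : projection (star v ** v) ->
  star v ** v ** star v = star v.
Proof.
move=> pv; have := congr1 (@star _ A) (partial_isometry_mulr pv).
by rewrite starM; case/projectionP: pv => -> _.
Qed.

Lemma partial_isometry_range v : projection (star v ** v) -> projection (v ** star v).
Proof.
move=> pv; apply/projectionP; rewrite starM starK; split => //.
by rewrite -smulA (smulA (star v)) partial_isometry_mull.
Qed.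

(** Let d = h(ab - ba) be nonzero and z = p(a) d an eigenvector of a. Without
    elements of square zero, (a - c)z = 0 forces (a - c) b z = 0, hence d z = 0
    and z z = p(a) d z = 0. *)
Lemma reduced_commutative h : central h -> h ** h = h ->
  (forall x, h ** x = x -> x ** x = 0 -> x = 0) ->
  forall a b, h ** (a ** b) = h ** (b ** a).
Proof.
move=> hC hh red a b; set d := h ** (a ** b - b ** a).
suff : d = 0 by rewrite /d smulBr => /eqP; rewrite subr_eq0 => /eqP.
apply/eqP/negPn/negP => d0; have [s sz] := alg a.
have [c [s' [_ z0 az]]] := roots_mul_factor d0 (sz d).
set z := roots_mul a s' d in z0 az; move/negP: z0; apply; apply/eqP.
have hz : h ** z = z.
  rewrite /z -roots_mul_comm ?hC //; congr (roots_mul _ _ _).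
  by rewrite -hC /d smulA hh.
have za : z ** a = c *: z.
  apply/eqP; rewrite -subr_eq0; apply/eqP/red.
    by rewrite smulBr smulA hz smulZr hz.
  set Y := _ - _; have aY : a ** Y = c *: Y.
    by rewrite /Y smulBr smulZr smulA az smulZl scalerBr.
  by rewrite {1}/Y smulBl smulZl -smulA aY smulZr subrr.
have abz : a ** b ** z = c *: (b ** z).
  apply/eqP; rewrite -subr_eq0; apply/eqP/red.
    have hyz y : h ** (y ** z) = y ** z by rewrite smulA hC -smulA hz.
    by rewrite smulBr smulZr !hyz.
  set X := _ - _; have zX : z ** X = 0.
    by rewrite /X smulBr smulZr !smulA za !smulZl subrr.
  by rewrite {1}/X smulBl smulZl -!smulA zX !smul0r scaler0 subrr.
apply: red => //; rewrite {1}/z -roots_mul_mulr.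
suff -> : d ** z = 0 by rewrite roots_mul0.
rewrite /d -smulA smulBl abz -(smulA b) az smulZr subrr smul0r //.
Qed.

End Spectral.

(** * Quotients by central projections *)

Section Linear.
Variables (R : realType) (U V : starAlgType R).
Lemma exists_linear (f : U -> V) :
  (forall (k : R[i]) x y, f (k *: x + y) = k *: f x + f y) ->
  exists phi : {linear U -> V}, phi =1 f.
Proof.
move=> lf.
pose m := GRing.isLinear.Build R[i] U V *:%R f lf.
by exists (HB.pack_for {linear U -> V} f m).
Qed.
End Linear.

(** The summand hA, seen as the image of A, is isomorphic to C. *)
Definition star_quotient (R : realType) (A C : starAlgType R) (h : A) :=
  exists phi : {linear A -> C},
    [/\ {morph phi : x y / x ** y}, {morph phi : x / star x},
        forall a, phi a = 0 <-> h ** a = 0 & forall c, exists a, phi a = c].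

(** * Orthogonal sequences *)

Section Orthogonal.
Variables (R : realType) (A : starAlgType R).
Hypothesis bA : baer A.
Variable u : A.
Hypotheses (pu : projection u) (u1 : forall x, u ** x = x).
Implicit Types (a b x y v w e f h p q : A).

Let u2 := unit_projection u1 pu.

(** The join s of the G n is the complement of their common annihilator.
    Since P n - G n annihilates all G m, it lies below that complement, so
    compressing s to the corner of P n leaves G n. *)
Lemma orthogonal_join (P G : nat -> A) : (forall n, projection (P n)) ->
  (forall m n, m <> n -> P m ** P n = 0) -> (forall n, projection (G n)) ->
  (forall n, P n ** G n = G n) ->
  exists2 s, star s = s & forall n, P n ** s = G n.
Proof.
move=> pP oP pG PG.
have GP n : G n ** P n = G n by apply/(projection_le_sym (pG n) (pP n)).
have [|f [/projectionP[sf ff] Gf f1]] := @baer_ann _ _ bA (range G).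
  by exists (G 0%N), 0%N.
have fPG n : f ** (P n - G n) = P n - G n.
  apply: f1 => _ [m _ <-]; rewrite smulBr; have [->|mn] := eqVneq m n.
    by rewrite GP; case/projectionP: (pG n) => _ ->; rewrite subrr.
  have mn' : m <> n by exact/eqP.
  rewrite -(GP m) -(PG n) -!smulA (smulA (P m) (P n)) (oP _ _ mn').
  by rewrite smul0l !smul0r subrr.
have PGf n : (P n - G n) ** f = P n - G n.
  case/projectionP: (pP n) (pG n) => sP _ /projectionP[sG _].
  by rewrite -{1}sP -{1}sG -starB -{1}sf -starM fPG starB sP sG.
have Gf0 n : G n ** f = 0 by apply: Gf; exists n.
exists (u - f); first by rewrite starB sf; case/projectionP: pu => ->.
move=> n; rewrite smulBr u2; move: (PGf n); rewrite smulBl Gf0 subr0 => ->.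
by rewrite opprB addrC subrK.
Qed.

Hypothesis alg : split_algebraic A.
Let proper := baer_proper bA.

(** In the corner of P n let v be a partial isometry of square zero and
    p = v v^*. With p, v, v^*, v^* v as the units of 2 x 2 matrices, g is the
    projection onto the line spanned by (1, n), so p g p = p / (1 + n^2). The
    joins e of the p and s of the g then give e s e the infinitely many
    eigenvalues 1 / (1 + n^2). *)
Lemma no_orthogonal_sqzero (P X : nat -> A) : (forall n, projection (P n)) ->
  (forall m n, m <> n -> P m ** P n = 0) ->
  (forall n, [/\ P n ** X n = X n, X n ** P n = X n, X n ** X n = 0 & X n != 0]) ->
  False.
Proof.
move=> pP oP PX.
have /choice[v Pv] n : exists v,
    [/\ v != 0, v ** v = 0, projection (star v ** v), P n ** v = v & v ** P n = v].
  have [PXn XPn XX X0] := PX n.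
  have [v [v0 vv pq l r]] := sqzero_partial_isometry alg proper XX X0.
  by exists v; split => //; [exact: l|exact: r].
pose p n := v n ** star (v n).
have pp n : projection (p n) by apply: partial_isometry_range => //; case: (Pv n).
have Pp n : P n ** p n = p n by rewrite smulA; case: (Pv n) => _ _ _ -> _.
(* y n is the column (1, n) over the matrix units, kap n its squared length *)
pose kap n : R[i] := (1 + n * n)%N%:R.
have kap0 n : kap n != 0 by rewrite pnatr_eq0.
have kapr n : conjc (kap n)^-1 = (kap n)^-1 by rewrite fmorphV /= /kap conjc_nat.
pose y n := p n + n%:R *: star (v n).
pose g n := (kap n)^-1 *: (y n ** star (y n)).
have py n : p n ** y n = p n.
  case: (Pv n) => _ vv _ _ _; have /projectionP[_ ppn] := pp n.
  rewrite smulDr ppn smulZr /p -smulA -starM vv star0 smul0r scaler0 addr0 //.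
have yp n : y n ** p n = y n.
  case: (Pv n) => _ vv pq _ _; have /projectionP[_ ppn] := pp n.
  by rewrite smulDl ppn smulZl /p smulA partial_isometry_mull.
have yy n : star (y n) ** y n = kap n *: p n.
  have /projectionP[spn ppn] := pp n.
  have [_ vv pq _ _] := Pv n.
  rewrite {1}/y starD starZ starK spn conjc_nat smulDl py smulZl /y smulDr smulZr.
  rewrite /p smulA vv smul0l add0r -/(p n) scalerA -natrM -{1}[p n]scale1r -scalerDl.
  by rewrite /kap natrD.
have pg n : projection (g n).
  apply/projectionP; rewrite /g starZ kapr starM starK; split => //.
  rewrite smulZl smulZr -smulA (smulA (star _)) yy smulZl smulZr; congr (_ *: _).
  have /projectionP[spn _] := pp n.
  rewrite scalerA mulVf // scale1r -{1}spn -starM.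
  by rewrite yp.
have Pg n : P n ** g n = g n.
  rewrite /g smulZr smulA; congr (_ *: (_ ** _)).
  case/projectionP: (pP n) => sP _; case: (Pv n) => _ _ _ _ vP.
  by rewrite /y smulDr Pp smulZr -{1}sP -starM vP.
have pgp n : p n ** g n ** p n = (kap n)^-1 *: p n.
  have /projectionP[spn ppn] := pp n.
  rewrite /g smulZr smulZl smulA py -smulA -{2}spn -starM py spn ppn //.
have [e se Pe] := orthogonal_join pP oP pp Pp.
have [s ss Ps] := orthogonal_join pP oP pg Pg.
have eP n : e ** P n = p n.
  case/projectionP: (pP n) (pp n) => sP _ /projectionP[sp _].
  by rewrite -{1}se -{1}sP -starM Pe.
have sP' n : s ** P n = g n.
  case/projectionP: (pP n) (pg n) => sP _ /projectionP[sp _].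
  by rewrite -{1}ss -{1}sP -starM Ps.
have eig n : (e ** s ** e) ** p n = (kap n)^-1 *: p n.
  have /projectionP[_ ppn] := pp n.
  have ep : e ** p n = p n by rewrite -(Pp n) smulA eP ppn.
  have sp : s ** p n = g n ** p n by rewrite -{1}(Pp n) smulA sP'.
  have eg : e ** g n = p n ** g n by rewrite -{1}(Pg n) smulA eP.
  by rewrite -smulA ep -smulA sp smulA eg pgp.
have [sq sqz] := alg (e ** s ** e).
have root n : (kap n)^-1 \in sq.
  have := sqz (p n); rewrite (roots_mul_eigen _ (eig n)) => /eqP.
  rewrite scaler_eq0 => /orP[|/eqP p0].
    by rewrite prodf_seq_eq0 => /hasP[d ds]; rewrite /= subr_eq0 => /eqP ->.
  have [v0 _ pq _ _] := Pv n.
  by case/eqP: v0; rewrite -(partial_isometry_mulr proper pq) smulA -/(p n) p0 smul0l.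
have : (size [seq (kap n)^-1 | n <- iota 0 (size sq).+1] <= size sq)%N.
  apply: uniq_leq_size.
    rewrite map_inj_uniq ?iota_uniq // => m n /invr_inj /eqP.
    by rewrite eqr_nat eqn_add2l !mulnn eqn_exp2r // => /eqP.
  by move=> _ /mapP[n _ ->].
by rewrite size_map size_iota ltnn.
Qed.

End Orthogonal.

(** * Decomposition into minimal projections *)

Section MinimalDecomposition.
Variables (R : realType) (A : starAlgType R) (Q : A -> Prop).
Hypothesis Q_projection : forall e, Q e -> projection e.
Hypothesis QB : forall e f, Q e -> Q f -> e ** f = f -> Q (e - f).
Hypothesis no_orthogonal_seq : forall E : nat -> A, (forall n, Q (E n)) ->
  (forall n, E n != 0) -> (forall m n, m <> n -> E m ** E n = 0) -> False.
Implicit Types (e f g : A) (s : seq A).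

Definition minimal_in g :=
  [/\ Q g, g != 0 & forall e, Q e -> g ** e = e -> e != 0 -> e = g].

Definition minimal_decomposition s e :=
  [/\ forall g, g \in s -> minimal_in g, pairwise (fun f g => f ** g == 0) s,
      forall g, g \in s -> e ** g = g & \sum_(g <- s) g = e].

Lemma minimal_decompositionD s1 s2 e f : Q e -> Q f -> e ** f = 0 ->
  minimal_decomposition s1 e -> minimal_decomposition s2 f ->
  minimal_decomposition (s1 ++ s2) (e + f).
Proof.
move=> Qe Qf ef [m1 o1 l1 e1] [m2 o2 l2 e2].
have fe := projection_orth_sym (Q_projection Qe) (Q_projection Qf) ef.
have r1 g : g \in s1 -> g ** e = g.
  move=> gs; have [Qg _ _] := m1 g gs.
  by apply/(projection_le_sym (Q_projection Qg) (Q_projection Qe)); exact: l1.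
split.
- by move=> g; rewrite mem_cat => /orP[/m1|/m2].
- rewrite pairwise_cat o1 o2 !andbT; apply/allrelP => g1 g2 /r1 g1e /l2 fg2.
  by rewrite -g1e -fg2 -smulA (smulA e) ef smul0l smul0r.
- move=> g; rewrite mem_cat => /orP[/l1 <-|/l2 <-].
    by rewrite smulDl !smulA fe smul0l addr0; case: (Q_projection Qe) => _ <-.
  by rewrite smulDl !smulA ef smul0l add0r; case: (Q_projection Qf) => _ <-.
- by rewrite big_cat e1 e2.
Qed.

(** If e had no decomposition, then e would not be minimal, and one of the two
    parts of a proper splitting of e would again have no decomposition.
    Iterating gives a strictly decreasing sequence, whose successive
    differences are orthogonal. *)
Lemma exists_minimal_decomposition e : Q e -> exists s, minimal_decomposition s e.
Proof.
move=> Qe; apply: contrapT => nfe.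
(* sigma type of counterexamples, on which the splitting step iterates *)
pose bad f := Q f /\ ~ exists s, minimal_decomposition s f.
have step (f : {f | bad f}) : exists g : {f | bad f},
    sval f ** sval g = sval g /\ sval g <> sval f.
  case: f => f [Qf nf] /=.
  have f0 : f != 0.
    apply/eqP => f0; apply: nf; exists [::]; split => //; last by rewrite big_nil.
  have [g [Qg fg g0 gf]] : exists g, [/\ Q g, f ** g = g, g != 0 & g <> f].
    apply: contrapT => ng; apply: nf; exists [:: f].
    case/projectionP: (Q_projection Qf) => _ ff.
    split => // [g|g|]; last by rewrite big_seq1.
      rewrite inE => /eqP ->; split => // g' Qg' fg' g'0.
      by apply: contrapT => gf'; apply: ng; exists g'.
    by rewrite inE => /eqP ->.
  have Qfg : Q (f - g) by exact: QB.
  have gfg : g ** (f - g) = 0.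
    case/projectionP: (Q_projection Qg) => _ gg.
    rewrite smulBr gg ((projection_le_sym (Q_projection Qg) (Q_projection Qf)).2 fg).
    by rewrite subrr.
  have [[s1 d1]|ng] := pselect (exists s, minimal_decomposition s g).
    have nfg : ~ exists s, minimal_decomposition s (f - g).
      move=> [s2 d2]; apply: nf; exists (s1 ++ s2).
      by have := minimal_decompositionD Qg Qfg gfg d1 d2; rewrite addrC subrK.
    exists (exist _ (f - g) (conj Qfg nfg)) => /=; split.
      by case/projectionP: (Q_projection Qf) => _ ff; rewrite smulBr ff fg.
    by move=> /eqP; rewrite -subr_eq0 addrAC subrr add0r oppr_eq0 (negbTE g0).
  by exists (exist _ g (conj Qg ng)).
have [F FP] := choice step.
pose E n := sval (iter n F (exist _ e (conj Qe nfe))).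
have QE n : Q (E n) by rewrite /E; case: (iter n _ _) => f [].
have ES n : E n ** E n.+1 = E n.+1 by case: (FP (iter n F (exist _ e (conj Qe nfe)))).
have EE n : E n ** E n = E n by case/projectionP: (Q_projection (QE n)).
have Ele m n : (m <= n)%N -> E m ** E n = E n.
  move=> /subnKC <-; elim: (n - m)%N => [|k IH]; rewrite ?addn0 //.
  by rewrite addnS -ES smulA IH.
have QD n : Q (E n - E n.+1) by apply: QB.
have orth m n : (m < n)%N -> (E m - E m.+1) ** (E n - E n.+1) = 0.
  by move=> mn; rewrite smulBl !smulBr !Ele ?subrr // ltnW // ltnW.
apply: (no_orthogonal_seq QD) => [n|m n].
  rewrite subr_eq0; apply/eqP => En.
  case: (FP (iter n F (exist _ e (conj Qe nfe)))) => _ [].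
  by rewrite -[LHS]/(E n.+1) -En.
have [mn|nm|->//] := ltngtP m n; move=> _.
  exact: orth.
apply: projection_orth_sym; [exact: Q_projection|exact: Q_projection|].
exact: orth.
Qed.

Lemma exists_minimal_family e : Q e -> exists n (g : 'I_n -> A),
  [/\ forall i, minimal_in (g i), forall i j, i != j -> g i ** g j = 0 &
      \sum_i g i = e].
Proof.
move=> /exists_minimal_decomposition[s [smin so _ se]].
exists (size s), (fun i => nth 0 s i); split.
- by move=> i; apply/smin/mem_nth.
- have olt (i j : 'I_(size s)) : (i < j)%N -> nth 0 s i ** nth 0 s j = 0.
    move=> ij; have /(pairwiseP 0) /(_ i j) := so.
    by rewrite !inE !ltn_ord => /(_ isT isT ij)/eqP.
  have Qs (i : 'I_(size s)) : projection (nth 0 s i).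
    by apply: Q_projection; case: (smin _ (mem_nth 0 (ltn_ord i))).
  move=> i j; rewrite -val_eqE neq_ltn => /orP[/olt //|/olt].
  exact: projection_orth_sym.
- by rewrite -se (big_nth 0) big_mkord.
Qed.

End MinimalDecomposition.

(** * Central projections and minimal projections *)

Section Structure.
Variables (R : realType) (A : starAlgType R).
Hypotheses (bA : baer A) (alg : split_algebraic A).
Variable u : A.
Hypotheses (pu : projection u) (u1 : forall x, u ** x = x).
Implicit Types (a b x y v w e f g h p q : A).

Let u2 := unit_projection u1 pu.
Let proper := baer_proper bA.

(** When the right annihilator fA is also a left ideal, b f = f b f for all b,
    and the adjoint of this for b^* is f b = f b f. *)
Lemma baer_central_ann (S : set A) : S !=set0 ->
  (forall v, (forall a, S a -> a ** v = 0) ->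
     forall b a, S a -> a ** (b ** v) = 0) ->
  exists f, [/\ projection f, central f, forall a, S a -> a ** f = 0 &
    forall y, (forall a, S a -> a ** y = 0) -> f ** y = y].
Proof.
move=> S0 Sid; have [f [pf Sf f1]] := baer_ann bA S0; exists f; split => //.
have fbf b : f ** (b ** f) = b ** f by apply: f1; exact: Sid.
move=> b; case/projectionP: pf => sf _.
have := congr1 (@star _ A) (fbf (star b)).
by rewrite !starM starK sf => <-; rewrite -smulA fbf.
Qed.

(** f generates the annihilator of the two-sided ideal of all (xy - yx)z. *)
Lemma abelian_summand : exists f, [/\ projection f, central f,
  forall x y, f ** (x ** y) = f ** (y ** x) &
  forall h, projection h -> central h ->
    (forall x y, h ** (x ** y) = h ** (y ** x)) -> f ** h = h].
Proof.
pose S := [set w | exists x y z, w = (x ** y - y ** x) ** z].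
have [||f [pf fC Sf f1]] := @baer_central_ann S.
- by exists ((0 ** 0 - 0 ** 0) ** 0), 0, 0, 0.
- move=> v Sv b _ [x [y [z ->]]].
  by rewrite smulA; apply: Sv; exists x, y, (z ** b); rewrite smulA.
exists f; split => // [x y|h ph hC hab].
  apply/eqP; rewrite -subr_eq0 -smulBr fC -(u1 f) smulA; apply/eqP/Sf.
  by exists x, y, u.
apply: f1 => _ [x [y [z ->]]].
by rewrite -smulA -hC smulA -hC smulBr hab subrr smul0l.
Qed.

(** With b = g a g, an eigenvector y of b in gA for c is annihilated on the left
    by b - c g and u - g. A projection that generates the annihilator of these
    two is nonzero and below g, so it is g, that is (b - c g) g = 0. *)
Lemma minimal_corner_scalar g a :
  minimal_in (fun e => projection e) g ->
  exists c : R[i], g ** a ** g = c *: g.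
Proof.
move=> [pg g0 gmin]; set b := g ** a ** g; case/projectionP: (pg) => sg gg.
have gb : g ** b = b by rewrite /b !smulA gg.
have bg : b ** g = b by rewrite /b -!smulA gg.
have [s sz] := alg b; have [c [s' [_ y0 by_]]] := roots_mul_factor g0 (sz g).
set y := roots_mul b s' g in y0 by_; exists c.
have gy : g ** y = y by rewrite /y -roots_mul_comm ?gg // gb bg.
have [|e [pe Se e1]] := @baer_ann _ _ bA [set b - c *: g; u - g].
  by exists (u - g); right.
have ey : e ** y = y.
  by apply: e1 => _ [] ->; rewrite smulBl ?smulZl gy ?by_ ?u1 subrr.
have ge : g ** e = e.
  by apply/eqP; rewrite eq_sym -subr_eq0 -{1}(u1 e) -smulBl; apply/eqP/Se; right.
have e0 : e != 0 by apply: contra_neq y0 => e0; rewrite -ey e0 smul0l.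
have eg := gmin _ pe ge e0; apply/eqP; rewrite -subr_eq0; apply/eqP.
by rewrite -[RHS](Se (b - c *: g)) ?eg; [rewrite smulBl smulZl bg gg|left].
Qed.

(** The annihilator of eA is generated by a central projection z. If e A f = 0
    then z lies above f, so h z is nonzero and equals h by minimality, and then
    e = e h z = 0. *)
Lemma minimal_central_link h e f :
  minimal_in (fun p => projection p /\ central p) h ->
  projection e -> projection f -> h ** e = e -> h ** f = f -> e != 0 -> f != 0 ->
  exists a, e ** a ** f != 0.
Proof.
move=> [[ph hC] h0 hmin] pe pf he hf e0 f0; apply: contrapT => na.
have eaf a : e ** a ** f = 0.
  by apply/eqP/negPn/negP => eaf; apply: na; exists a.
have [||z [pz zC Sz z1]] := @baer_central_ann (range (smul e)).
- by exists (e ** 0), 0.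
- move=> v Sv b _ [a _ <-].
  by rewrite smulA -smulA; rewrite smulA -(smulA e); apply: Sv; exists (a ** b).
have zf : z ** f = f by apply: z1 => _ [a _ <-]; exact: eaf.
have /projectionP[sh hh] := ph; have /projectionP[sz zz] := pz.
have hz : h ** z = h.
  apply: hmin; first split.
  - apply/projectionP; rewrite starM sz sh -hC; split=> //.
    by rewrite -smulA (smulA z) -hC -smulA zz smulA hh.
  - by move=> x; rewrite -smulA zC smulA hC -smulA.
  - by rewrite smulA hh.
  - by apply: contra_neq f0 => hz; rewrite -hf -zf smulA hz smul0l.
have ez : e ** z = 0 by rewrite -(u2 e); apply: Sz; exists u.
by case/eqP: e0; rewrite -he -hz -smulA zC ez smul0r.
Qed.

End Structure.

(** * Assembling quotients, matrix units *)

Section Quotients.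
Variables (R : realType) (A : starAlgType R).
Implicit Types (a b x y v w e f g h p q : A).

Lemma star_quotient_unique (C : starAlgType R) h (phi : {linear A -> C}) a b :
  (forall a, phi a = 0 <-> h ** a = 0) -> h ** a = h ** b -> phi a = phi b.
Proof.
move=> ker hab; apply/eqP; rewrite -subr_eq0 -linearB; apply/eqP/ker.
by rewrite smulBr hab subrr.
Qed.

Lemma star_quotient_iso (C : starAlgType R) u : (forall x, u ** x = x) ->
  star_quotient C u -> star_isomorphic A C.
Proof.
move=> u1 [phi [phiM phiS ker surj]]; exists phi; split => //.
have [g gP] := choice surj.
have inj : injective phi.
  move=> a b ab; apply/eqP; rewrite -subr_eq0 -(u1 (_ - _)); apply/eqP/ker.
  by rewrite linearB /= ab subrr.
by exists g => // a; apply: inj; rewrite gP.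
Qed.

Lemma star_quotientD (C1 C2 : starAlgType R) h1 h2 :
  projection h1 -> projection h2 -> h1 ** h2 = 0 ->
  star_quotient C1 h1 -> star_quotient C2 h2 ->
  star_quotient (C1 * C2)%type (h1 + h2).
Proof.
move=> p1 p2 h12 [phi1 [M1 S1 k1 s1]] [phi2 [M2 S2 k2 s2]].
have h21 := projection_orth_sym p1 p2 h12.
case/projectionP: p1 => _ h11; case/projectionP: p2 => _ h22.
have [|phi phiE] := @exists_linear _ A (C1 * C2)%type (fun a => (phi1 a, phi2 a)).
  by move=> k x y; rewrite !linearP.
exists phi; split.
- by move=> x y; rewrite !phiE M1 M2.
- by move=> x; rewrite !phiE S1 S2.
- move=> a; rewrite phiE; split.
    by move=> [/k1 a1 /k2 a2]; rewrite smulDl a1 a2 addr0.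
  move=> ha; have e1 : phi1 a = 0.
    apply/k1; have := congr1 (smul h1) ha.
    by rewrite smulA smulDr h11 h12 addr0 smul0r.
  have -> : phi2 a = 0; last by rewrite e1.
  apply/k2; have := congr1 (smul h2) ha.
  by rewrite smulA smulDr h22 h21 add0r smul0r.
- move=> [c1 c2]; have [a1 <-] := s1 c1; have [a2 <-] := s2 c2.
  exists (h1 ** a1 + h2 ** a2); rewrite phiE; congr (_, _).
    by apply: (star_quotient_unique k1); rewrite smulDr !smulA h11 h12 smul0l addr0.
  by apply: (star_quotient_unique k2); rewrite smulDr !smulA h22 h21 smul0l add0r.
Qed.

Lemma star_quotient_dirsum k (C : 'I_k -> starAlgType R) (h : 'I_k -> A) :
  (forall i, h i ** h i = h i) -> (forall i j, i != j -> h i ** h j = 0) ->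
  (forall i, star_quotient (C i) (h i)) ->
  star_quotient (dirsum C) (\sum_i h i).
Proof.
move=> hh orth q.
have hsum i (f : 'I_k -> A) : h i ** (\sum_j h j ** f j) = h i ** f i.
  rewrite smul_sumr (bigD1 i) //= smulA hh big1 ?addr0 // => j ji.
  by rewrite smulA orth ?smul0l // eq_sym.
pose phi i := projT1 (cid (q i)).
have phiP i := projT2 (cid (q i)).
have [|Phi PhiE] := @exists_linear _ A (dirsum C) (fun a i => phi i a).
  by move=> c x y; apply: functional_extensionality_dep => i; rewrite linearP.
exists Phi; split.
- move=> x y; rewrite !PhiE; apply: functional_extensionality_dep => i.
  by case: (phiP i) => M _ _ _; exact: M.
- move=> x; rewrite !PhiE; apply: functional_extensionality_dep => i.
  by case: (phiP i) => _ S _ _; exact: S.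
- move=> a; rewrite PhiE; split=> [a0|ha].
    rewrite smul_suml big1 // => i _; case: (phiP i) => _ _ ker _; apply/ker.
    exact: (congr1 (fun f : dirsum C => f i) a0).
  apply: functional_extensionality_dep => i; case: (phiP i) => _ _ ker _; apply/ker.
  by rewrite -(hsum i (fun=> a)) -smul_suml ha smul0r.
- move=> c.
  have /choice[f fP] i : exists a, phi i a = c i by case: (phiP i) => _ _ _; exact.
  exists (\sum_i h i ** f i); rewrite PhiE; apply: functional_extensionality_dep => i.
  rewrite -fP; case: (phiP i) => _ _ ker _; apply: (star_quotient_unique ker).
  exact: hsum.
Qed.

(** The entry (i, j) of the image of a is the scalar by which v_i^* a v_j
    multiplies g; the product formula is the insertion of h = sum v_k v_k^*. *)
Lemma matrix_units_quotient n (v : 'I_n -> A) g h : central h -> g != 0 ->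
  (forall i, v i ** g = v i) ->
  (forall i j, star (v i) ** v j = if i == j then g else 0) ->
  \sum_i v i ** star (v i) = h ->
  (forall a, exists c : R[i], g ** a ** g = c *: g) ->
  projection g ->
  star_quotient 'M[R[i]]_n h.
Proof.
move=> hC g0 vg vv sv corner /projectionP[sg gg].
have ginj (c d : R[i]) : c *: g = d *: g -> c = d.
  move=> /eqP; rewrite -subr_eq0 -scalerBl scaler_eq0 (negbTE g0) orbF.
  by rewrite subr_eq0 => /eqP.
have gv i : g ** star (v i) = star (v i) by rewrite -{2}(vg i) starM sg.
have hv i : h ** v i = v i.
  rewrite -sv smul_suml (bigD1 i) //= -smulA vv eqxx vg big1 ?addr0 // => j ji.
  by rewrite -smulA vv (negbTE ji) smul0r.
have hh : h ** h = h.
  by rewrite -{2 3}sv smul_sumr; apply: eq_bigr => i _; rewrite smulA hv.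
have [K KP] := choice corner.
have KE i j a : star (v i) ** a ** v j = K (star (v i) ** a ** v j) *: g.
  by rewrite -KP !smulA gv -!smulA vg.
have [|phi phiE] := @exists_linear _ A 'M[R[i]]_n
    (fun a => \matrix_(i, j) K (star (v i) ** a ** v j)).
  move=> k x y; apply/matrixP => i j; rewrite !mxE; apply: ginj.
  rewrite scalerDl -scalerA -!KE.
  by rewrite smulDr smulDl smulZr smulZl.
have phiK i j a : phi a i j *: g = star (v i) ** a ** v j by rewrite phiE mxE -KE.
exists phi; split.
- move=> a b; apply/matrixP => i j; rewrite [RHS]mxE; apply: ginj.
  rewrite phiK scaler_suml.
  transitivity (star (v i) ** a ** h ** (b ** v j)).
    by rewrite -!smulA (smulA h) hC -!smulA hv.
  rewrite -sv smul_sumr smul_suml; apply: eq_bigr => k _.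
  have -> : (phi a i k * phi b k j) *: g = (phi a i k *: g) ** (phi b k j *: g).
    rewrite smulZl smulZr scalerA; congr (_ *: _).
    by rewrite gg.
  by rewrite !phiK !smulA.
- move=> a; apply/matrixP => i j; rewrite !mxE; apply: ginj.
  rewrite phiK -sg -starZ phiK.
  by rewrite !starM starK smulA.
- move=> a; split => [a0|ha].
    suff : h ** a ** h = 0 by rewrite -smulA -hC smulA hh.
    rewrite -{1}sv smul_suml smul_suml big1 // => i _.
    rewrite -sv smul_sumr big1 // => j _.
    have := phiK i j a; rewrite a0 mxE scale0r => e.
    transitivity (v i ** (star (v i) ** a ** v j) ** star (v j)).
      by rewrite !smulA.
    by rewrite -e smul0r smul0l.
  apply/matrixP => i j; rewrite [RHS]mxE; apply: ginj; rewrite phiK scale0r.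
  by rewrite -(hv j) smulA -(smulA _ a) -hC ha smul0r smul0l.
- move=> c; exists (\sum_i \sum_j c i j *: (v i ** star (v j))).
  apply/matrixP => k l; apply: ginj; rewrite phiK.
  rewrite smul_sumr smul_suml (bigD1 k) //= smul_sumr smul_suml (bigD1 l) //=.
  rewrite smulZr smulZl !smulA vv eqxx -!smulA vv eqxx big1 => [|j jl].
    rewrite addr0 big1 => [|i ik].
      by rewrite addr0 gg.
    rewrite smul_sumr smul_suml big1 // => j _.
    by rewrite smulZr smulZl !smulA vv eq_sym (negbTE ik) !smul0l scaler0.
  by rewrite smulZr smulZl -!smulA vv (negbTE jl) !smul0r scaler0.
Qed.

End Quotients.

(** * The noncommutative summand *)

Section Factors.
Variables (R : realType) (A : starAlgType R).
Hypotheses (bA : baer A) (alg : split_algebraic A).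
Variable u : A.
Hypotheses (pu : projection u) (u1 : forall x, u ** x = x).
Implicit Types (a b x y v w e f g h p q : A).

Let u2 := unit_projection u1 pu.
Let proper := baer_proper bA.

(** An infinite orthogonal sequence E of projections below h is excluded by
    linking E (2 n) with E (2 n + 1): the link has square zero in the corner
    of their sum. So h is a finite sum of minimal projections g_i; the partial
    isometry made from a link between g_i and g_0 has initial and final
    projections g_0 and g_i by minimality. *)
Lemma factor_quotient h :
  minimal_in (fun p => projection p /\ central p) h ->
  ~ (forall x y, h ** (x ** y) = h ** (y ** x)) ->
  exists n, (2 <= n)%N /\ star_quotient 'M[R[i]]_n h.
Proof.
move=> hmin nab; have [[ph hC] h0 _] := hmin.
have link := minimal_central_link bA pu u1 hmin.
pose Q e := projection e /\ h ** e = e.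
have [n [g [Qmin og gsum]]] : exists n (g : 'I_n -> A),
    [/\ forall i, minimal_in Q (g i), forall i j, i != j -> g i ** g j = 0 &
        \sum_i g i = h].
  apply: exists_minimal_family.
  - by move=> e [].
  - move=> e f [pe he] [pf hf] ef; split; first exact: projectionB.
    by rewrite smulBr he hf.
  - move=> E QE E0 oE.
    have /choice[a aE] n : exists a, E n.*2 ** a ** E n.*2.+1 != 0.
      by have [pe he] := QE n.*2; have [pf hf] := QE n.*2.+1; apply: link.
    have EE n : E n ** E n = E n by case: (QE n) => /projectionP[].
    apply: (@no_orthogonal_sqzero _ _ bA u pu u1 alg (fun n => E n.*2 + E n.*2.+1)
              (fun n => E n.*2 ** a n ** E n.*2.+1)).
    + move=> n; apply: projectionD; [by case: (QE n.*2)|by case: (QE n.*2.+1)|].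
      by apply: oE; lia.
    + by move=> m n mn; rewrite smulDl !smulDr !oE ?addr0 //; lia.
    + move=> n; split => //.
      * by rewrite smulDl !smulA EE (oE n.*2.+1) ?smul0l ?addr0 //; lia.
      * by rewrite smulDr -!smulA EE (oE n.*2.+1) ?smul0r ?add0r //; lia.
      * by rewrite -!smulA (smulA (E _) (E _)) (oE n.*2.+1) ?smul0l ?smul0r //; lia.
  - by split => //; case/projectionP: ph.
have gmin i : minimal_in (fun e => projection e) (g i).
  have [[pg hg] g0 gm] := Qmin i; split => // e pe ge e0.
  by apply: gm => //; split=> //; rewrite -ge smulA hg.
have pg i : projection (g i) by case: (gmin i).
have gg i : g i ** g i = g i by case/projectionP: (pg i).
have hg i : h ** g i = g i by case: (Qmin i) => -[].
have corner i a : exists c : R[i], g i ** a ** g i = c *: g i.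
  exact: (minimal_corner_scalar bA alg u1 _ (gmin i)).
have n0 : (0 < n)%N.
  rewrite lt0n; apply: contra_neq h0 => n0; rewrite -gsum big1 // => i _.
  by have := ltn_ord i; rewrite [X in (_ < X)%N]n0.
have n2 : (2 <= n)%N.
  rewrite ltnNge; apply/negP => n1; apply: nab => x y.
  have [i iP] : exists i, h = g i.
    have i0 : 'I_n by exists 0%N.
    exists i0; rewrite -gsum (bigD1 i0) //= big1 ?addr0 // => j ji.
    by move: ji; rewrite -val_eqE /=; have := ltn_ord j; have := ltn_ord i0; lia.
  have hx z : exists c : R[i], h ** z = c *: h.
    have [c cP] := corner i z; exists c; rewrite iP -cP -iP -smulA -hC smulA.
    by rewrite iP gg.
  have [c cx] := hx x; have [d dy] := hx y.
  by rewrite !smulA cx dy !smulZl cx dy !scalerA mulrC.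
exists n; split => //.
(* all v_i start from the same projection g_0 *)
pose i0 : 'I_n := Ordinal (ltnW n2).
have /choice[v vP] i : exists v, star v ** v = g i0 /\ v ** star v = g i.
  have [->|ii0] := eqVneq i i0.
    by exists (g i0); case/projectionP: (pg i0) => -> ->.
  have [_ gi0 mi] := gmin i; have [_ g00 mi0] := gmin i0.
  have [a a0] : exists a, g i ** a ** g i0 != 0.
    by apply: link.
  have [|v [v0 vv pv l r]] := sqzero_partial_isometry alg proper _ a0.
    by rewrite -!smulA (smulA (g i0)) og ?smul0l ?smul0r // eq_sym.
  have gv : g i ** v = v by apply: l; rewrite !smulA gg.
  have vg : v ** g i0 = v by apply: r; rewrite -!smulA gg.
  exists v; split.
    apply: mi0 => //.
      suff e : g i0 ** star v = star v by rewrite smulA e.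
      by rewrite -{2}vg starM; case/projectionP: (pg i0) => -> _.
    by apply: contra_neq v0; exact: proper.
  apply: mi => //; first exact: partial_isometry_range.
    by rewrite smulA gv.
  apply: contra_neq v0 => vv0.
  by rewrite -(partial_isometry_mulr proper pv) smulA vv0 smul0l.
have g00 : g i0 != 0 by case: (gmin i0).
have pv i : projection (star (v i) ** v i) by case: (vP i) => -> _.
have vg i : v i ** g i0 = v i.
  by case: (vP i) => <- _; exact: partial_isometry_mulr.
have gv i : g i ** v i = v i.
  by case: (vP i) => e <-; rewrite -smulA e vg.
apply: (matrix_units_quotient (v := v) (g := g i0)) => //.
- move=> i j; case: eqP => [->|/eqP ij]; first by case: (vP j).
  rewrite -(gv j) -(gv i) starM; case/projectionP: (pg i) => -> _.
  by rewrite -smulA (smulA (g i)) og // smul0l smul0r.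
- by rewrite -gsum; apply: eq_bigr => i _; case: (vP i).
Qed.

End Factors.

Section CentralDecomposition.
Variables (R : realType) (A : starAlgType R).
Hypotheses (bA : baer A) (alg : split_algebraic A).
Variable u : A.
Hypotheses (pu : projection u) (u1 : forall x, u ** x = x).
Implicit Types (a b x y v w e f g h p q t : A).

Let u2 := unit_projection u1 pu.
Let proper := baer_proper bA.

(** A sequence of orthogonal central projections below t is excluded since each
    of them has an element of square zero; so t is a finite sum of minimal
    central projections. *)
Lemma noncommutative_quotient t : projection t -> central t ->
  (forall h, projection h -> central h -> t ** h = h ->
    (forall x y, h ** (x ** y) = h ** (y ** x)) -> h = 0) ->
  exists k (n : 'I_k -> nat), (forall i, (2 <= n i)%N) /\
    star_quotient (matrix_sum R n) t.
Proof.
move=> pt tC nab.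
pose Q h := (projection h /\ central h) /\ t ** h = h.
have Qsq h : Q h -> h != 0 -> exists x, [/\ h ** x = x, x ** x = 0 & x != 0].
  move=> [[ph hC] th] h0; apply: contrapT => nx; case/eqP: h0; apply: nab => //.
  case/projectionP: ph => _ hh.
  apply: (reduced_commutative alg hC hh) => x hx xx.
  by apply/eqP/negPn/negP => x0; apply: nx; exists x.
have [k [h [hmin oh hsum]]] : exists k (h : 'I_k -> A),
    [/\ forall i, minimal_in Q (h i), forall i j, i != j -> h i ** h j = 0 &
        \sum_i h i = t].
  apply: exists_minimal_family.
  - by move=> h [[]].
  - move=> e f [[pe eC] te] [[pf fC] tf] ef; split; last by rewrite smulBr te tf.
    split; first exact: projectionB.
    by move=> x; rewrite smulBl smulBr eC fC.
  - move=> E QE E0 oE.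
    have [X XP] := choice (fun n => Qsq _ (QE n) (E0 n)).
    apply: (no_orthogonal_sqzero bA pu u1 alg (P := E) (X := X)) => [n||n] //.
      by case: (QE n) => -[].
    by case: (XP n) => EX XX X0; case: (QE n) => -[_ EC] _; rewrite -EC.
  - by split => //; case/projectionP: pt.
have ph i : projection (h i) by case: (hmin i) => -[[]].
have /choice[n nP] i : exists n, (2 <= n)%N /\ star_quotient 'M[R[i]]_n (h i).
  have [[[_ hC] th] h0 hm] := hmin i.
  apply: (factor_quotient bA alg pu u1).
    split => // e [pe eC] he; apply: hm => //; split => //.
    by rewrite -he smulA th.
  by move=> hab; case/eqP: h0; apply: nab.
exists k, n; split; first by move=> i; case: (nP i).
rewrite -hsum; apply: star_quotient_dirsum => //; last by move=> i; case: (nP i).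
by move=> i; case/projectionP: (ph i).
Qed.

End CentralDecomposition.

(** * The character space of the commutative summand *)

Section SpectrumDef.
Variables (R : realType) (A : starAlgType R) (f : A).

(** Characters of A that do not vanish on f; as f is an idempotent this means
    that they are characters of fA. *)
Record spectrum := Character {
  character_fun :> A -> R[i];
  character_linear : forall (k : R[i]) x y,
    character_fun (k *: x + y) = k * character_fun x + character_fun y;
  characterM : forall x y,
    character_fun (x ** y) = character_fun x * character_fun y;
  character_unit : character_fun f = 1 }.

HB.instance Definition _ := gen_eqMixin spectrum.
HB.instance Definition _ := gen_choiceMixin spectrum.

(** These sets are closed under intersection, since characters are
    multiplicative, and form the base of the topology. *)
Definition cozero (a : A) : set spectrum := [set chi : spectrum | chi a != 0].

Let spectrum_open (V : set spectrum) :=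
  forall chi, V chi -> exists2 a, cozero a chi & cozero a `<=` V.

Let spectrum_openT : spectrum_open setT.
Proof.
by move=> chi _; exists f => //; rewrite /cozero /= character_unit oner_neq0.
Qed.

Let spectrum_openI V W :
  spectrum_open V -> spectrum_open W -> spectrum_open (V `&` W).
Proof.
move=> oV oW chi [/oV[a achi aV] /oW[b bchi bW]]; exists (a ** b).
  by rewrite /cozero /= characterM mulf_neq0.
move=> phi; rewrite /cozero /= characterM mulf_eq0 negb_or => /andP[? ?].
by split; [exact: aV|exact: bW].
Qed.

Let spectrum_open_bigU I (F : I -> set spectrum) :
  (forall i, spectrum_open (F i)) -> spectrum_open (\bigcup_i F i).
Proof.
move=> oF chi [i _ /oF[a achi aF]]; exists a => // phi /aF Fphi.
by exists i.
Qed.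

HB.instance Definition _ := isOpenTopological.Build spectrum
  spectrum_openT spectrum_openI spectrum_open_bigU.

Lemma spectrum_openE V : open V =
  forall chi : spectrum, V chi -> exists2 a, cozero a chi & cozero a `<=` V.
Proof. by []. Qed.

Lemma open_cozero a : open (cozero a).
Proof. by rewrite spectrum_openE => chi achi; exists a. Qed.

End SpectrumDef.

Section Spectrum.
Variables (R : realType) (A : starAlgType R).
Hypotheses (bA : baer A) (alg : split_algebraic A).
Variable f : A.
Implicit Types (a b x y v w e g h p q t : A) (chi : spectrum f).

Let proper := baer_proper bA.

Lemma characterD chi x y : chi (x + y) = chi x + chi y.
Proof. by rewrite -(scale1r x) character_linear mul1r scale1r. Qed.
Lemma character0 chi : chi 0 = 0.
Proof. by apply: (addrI (chi 0)); rewrite -characterD !addr0. Qed.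
Lemma characterZ chi k x : chi (k *: x) = k * chi x.
Proof. by rewrite -(addr0 (k *: x)) character_linear character0 addr0. Qed.
Lemma characterB chi x y : chi (x - y) = chi x - chi y.
Proof. by rewrite -scaleN1r characterD characterZ mulN1r. Qed.

Lemma character_roots_mul chi a s b :
  chi (roots_mul a s b) = (\prod_(c <- s) (chi a - c)) * chi b.
Proof.
elim: s => [|c s IH] /=; first by rewrite big_nil mul1r.
by rewrite characterB characterM characterZ IH big_cons -!mulrA -mulrBl.
Qed.

Lemma character_root chi a s : roots_mul a s f = 0 -> chi a \in s.
Proof.
move=> /(congr1 chi); rewrite character_roots_mul character_unit mulr1 character0.
move=> /eqP; rewrite prodf_seq_eq0 => /hasP[c cs /=].
by rewrite subr_eq0 => /eqP ->.
Qed.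

Lemma character_projection chi e : projection e -> chi e != 0 -> chi e = 1.
Proof.
move=> /projectionP[_ ee] e0; apply: (mulfI e0).
by rewrite mulr1 -characterM ee.
Qed.

(** A character takes a self-adjoint element to one of its eigenvalues, which
    is real; apply this to the real and imaginary parts of a. *)
Lemma character_star chi a : chi (star a) = conjc (chi a).
Proof.
have real b : star b = b -> conjc (chi b) = chi b.
  move=> sb; have [s sz] := alg b.
  have := character_root chi (self_adjoint_real_split proper sb (sz f)).
  by rewrite mem_filter => /andP[/eqP].
have e1 : conjc (chi (a + star a)) = chi (a + star a).
  by apply: real; rewrite starD starK addrC.
have [i ci i0] : exists2 i : R[i], conjc i = - i & i != 0.
  exists 'i%C; first by apply/eqP; rewrite eq_complex /= !oppr0 !eqxx.
  by rewrite eq_complex /= oner_eq0 andbF.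
(* i (a - a^* ) is self-adjoint as well *)
have e2 : conjc (chi (i *: (a - star a))) = chi (i *: (a - star a)).
  apply: real; rewrite starZ starB starK -opprB ci.
  by rewrite scaleNr scalerN opprK.
rewrite !characterD rmorphD in e1.
rewrite !characterZ characterB rmorphM rmorphB /= ci in e2.
have e3 : chi (star a) - chi a = conjc (chi a) - conjc (chi (star a)).
  by apply: (mulfI i0); rewrite -[LHS]opprK -mulrN opprB -e2 mulNr opprK.
have two0 : 2 != 0 :> R[i] by rewrite pnatr_eq0.
apply: (mulIf two0); rewrite !mulr_natr !mulr2n.
transitivity ((chi a + chi (star a)) + (chi (star a) - chi a)).
  by rewrite addrC addrA subrK.
by rewrite e3 -e1 addrACA subrr addr0.
Qed.

(** A character takes a to some c in s; the product of the a - c over the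
    nonzero c in s vanishes there unless a does. *)
Lemma cozeroC a : exists b, ~` cozero a = cozero b :> set (spectrum f).
Proof.
have [s sz] := alg a; exists (roots_mul a [seq c <- s | c != 0] f).
apply/seteqP; split => chi; rewrite /cozero /= character_roots_mul character_unit mulr1.
  move=> /negP; rewrite negbK => /eqP a0; rewrite prodf_seq_neq0; apply/allP => c /=.
  by rewrite mem_filter a0 sub0r oppr_eq0 => /andP[].
rewrite prodf_seq_neq0 => /allP nz a0.
have := nz (chi a); rewrite mem_filter a0 (character_root chi (sz f)) /= => /(_ isT).
by rewrite subrr eqxx.
Qed.

Lemma clopen_cozero a : clopen (cozero a : set (spectrum f)).
Proof.
split; first exact: open_cozero.
have [b e] := cozeroC a; rewrite -(setCK (cozero a)) e; apply: open_closedC.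
exact: open_cozero.
Qed.

Lemma spectrum_hausdorff : hausdorff_space (spectrum f).
Proof.
rewrite open_hausdorff => chi phi cp.
have [a ap] : exists a, chi a != phi a.
  apply: contrapT => na; case/eqP: cp.
  have e : chi = phi :> (A -> R[i]).
    apply/funext => a; apply/eqP/negPn/negP => ca; apply: na; exists a.
    exact: ca.
  case: chi phi e {na} => c c1 c2 c3 [d d1 d2 d3] /= e.
  by case: _ / e d1 d2 d3 => d1 d2 d3; congr Character; exact: Prop_irrelevance.
have [b e] := cozeroC (a - phi a *: f).
exists (cozero (a - phi a *: f), cozero b) => /=; split.
- rewrite inE /cozero /= characterB characterZ character_unit mulr1.
  by rewrite subr_eq0.
- rewrite -e inE /cozero /= characterB characterZ character_unit mulr1 subrr eqxx.
  by [].
- exact: open_cozero.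
- exact: open_cozero.
- by rewrite -e setICr.
Qed.

(** Along an ultrafilter each element a of A is eventually constant, having
    finitely many values on characters; the eventual values form a character,
    to which the ultrafilter converges. *)
Lemma spectrum_compact : compact [set: spectrum f].
Proof.
rewrite compact_ultra => F FU _.
have FF : ProperFilter F by exact: ultra_proper.
have /choice[lim limP] a : exists c, F [set chi : spectrum f | chi a = c].
  have [s sz] := alg a.
  have : F [set chi : spectrum f | chi a \in s].
    by apply: filterS filterT => chi _; exact: character_root.
  elim: s {sz} => [Fs|c s IH Fs].
    by exists 0; apply: filterS Fs.
  have [Fc|Fc] := in_ultra_setVsetC [set chi : spectrum f | chi a = c] FU.
    by exists c.
  apply: IH; apply: filterS (filterI Fs Fc) => chi /= [].
  by rewrite inE => /orP[/eqP|].
have wit (V : set (spectrum f)) : F V -> exists chi, V chi.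
  by move=> FV; exact: filter_ex FV.
have lin (k : R[i]) x y : lim (k *: x + y) = k * lim x + lim y.
  have [chi [/= <- [/= <- <-]]] := wit _
    (filterI (limP (k *: x + y)) (filterI (limP x) (limP y))).
  exact: character_linear.
have mul x y : lim (x ** y) = lim x * lim y.
  have [chi [/= <- [/= <- <-]]] := wit _
    (filterI (limP (x ** y)) (filterI (limP x) (limP y))).
  exact: characterM.
have un : lim f = 1.
  by have [chi /= <-] := wit _ (limP f); exact: character_unit.
exists (Character lin mul un); split => // V.
rewrite nbhsE => -[W [oW Wl] WV]; apply: filterS WV _.
have := oW; rewrite spectrum_openE => /(_ _ Wl)[a al aW].
apply: filterS (limP a) => chi /= ca; apply: aW.
by rewrite /cozero /= ca.
Qed.

Hypotheses (pf : projection f) (fC : central f).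
Hypothesis separating : forall a, (forall chi, chi a = 0) -> f ** a = 0.

(** Let eA be the annihilator of the elements supported in V. Then e vanishes
    on V; and if cozero b is disjoint from V, then f b lies in that
    annihilator, so e is nonzero on cozero b. *)
Lemma closure_open_spectrum (V : set (spectrum f)) : open V ->
  exists2 e, projection e & closure V = ~` cozero e.
Proof.
move=> oV.
have [|e [pe Se e1]] := @baer_ann _ _ bA [set a | cozero a `<=` V].
  by exists 0 => chi; rewrite /cozero /= character0 eqxx.
exists e => //; apply/seteqP; split => chi.
  move=> cV ce; have [phi [Vphi ephi]] :=
    cV _ (open_nbhs_nbhs (conj (@open_cozero _ _ f e) ce)).
  have := oV; rewrite spectrum_openE => /(_ _ Vphi)[a aphi aV].
  have := congr1 phi (Se _ aV); rewrite characterM character0 => /eqP.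
  by rewrite mulf_eq0 (negbTE aphi) (negbTE ephi).
move=> ce B; rewrite nbhsE => -[W [oW Wchi] WB].
have := oW; rewrite spectrum_openE => /(_ _ Wchi)[b bchi bW].
apply: contrapT => VB; apply: ce.
have eb : e ** (f ** b) = f ** b.
  apply: e1 => a aV; rewrite smulA -fC -smulA; apply: separating => phi.
  rewrite characterM; apply/eqP; rewrite mulf_eq0; apply: contrapT => /negP.
  rewrite negb_or => /andP[aphi bphi]; apply: VB; exists phi; split.
    exact: aV.
  by apply: WB; exact: bW.
have := congr1 chi eb; rewrite !characterM character_unit mul1r => eb'.
by rewrite /cozero /=; apply: contra_neq bchi => e0; rewrite -eb' e0 mul0r.
Qed.

Lemma spectrum_stonean : stonean (spectrum f).
Proof.
split; [exact: spectrum_compact|exact: spectrum_hausdorff|].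
move=> V /closure_open_spectrum[e pe ->].
by have [b ->] := cozeroC e; exact: open_cozero.
Qed.

(** Apply [closure_open_spectrum] to the complement of W. *)
Lemma clopen_spectrum (W : set (spectrum f)) : clopen W ->
  exists e, forall chi, chi e = \1_W chi.
Proof.
move=> [oW cW].
have [e pe eW] := closure_open_spectrum (closed_openC cW).
exists e => chi; have cC : closed (~` W) by exact: open_closedC.
move: eW; rewrite -(closure_id _).1 // => /(congr1 (@setC _)); rewrite !setCK => ->.
rewrite indicE; have [ce|ce] := eqVneq (chi e) 0.
  by rewrite memNset // /cozero /= ce eqxx.
by rewrite mem_set // character_projection.
Qed.

(** An element takes finitely many values, each on a clopen set. *)
Lemma evaluation_in_clopen_span a :
  (fun chi => chi a) \in @clopen_span_pred R (spectrum f).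
Proof.
have [s0 sz0] := alg a; set s := undup s0.
have sP chi : chi a \in s by rewrite mem_undup; exact: character_root.
apply/asboolP; exists (size s), (fun i => s`_i),
  (fun i => [set chi : spectrum f | chi a = s`_i]); split.
  move=> i; have [b e] := cozeroC (a - s`_i *: f).
  suff -> : [set chi : spectrum f | chi a = s`_i] = cozero b :> set (spectrum f).
    exact: clopen_cozero.
  rewrite -e; apply/seteqP; split => chi;
    rewrite /cozero /= characterB characterZ character_unit mulr1 subr_eq0.
    by move=> ->; rewrite eqxx.
  by move=> /negP; rewrite negbK => /eqP.
apply/funext => chi; rewrite fct_sumE.
have is_ : (index (chi a) s < size s)%N by rewrite index_mem.
rewrite (bigD1 (Ordinal is_)) //= big1 => [|i].
  by rewrite addr0 /GRing.scale /= indicE mem_set ?nth_index //=; exact/esym/mulr1.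
rewrite -val_eqE /= => ii; rewrite /GRing.scale /= indicE memNset /=.
  exact: mulr0.
by move=> e; case/eqP: ii; rewrite e index_uniq // undup_uniq.
Qed.

Lemma spectrum_quotient : star_quotient (clopen_span R (spectrum f)) f.
Proof.
have [|psi psiE] := @exists_linear _ A (clopen_span R (spectrum f))
    (fun a => ClopenSpan (evaluation_in_clopen_span a)).
  by move=> k x y; apply: clopen_span_ext => chi; exact: character_linear.
exists psi; split.
- by move=> x y; rewrite !psiE; apply: clopen_span_ext => chi; exact: characterM.
- by move=> x; rewrite !psiE; apply: clopen_span_ext => chi; exact: character_star.
- move=> a; rewrite psiE; split => [a0|fa].
    by apply: separating => chi; exact: (congr1 (fun g : clopen_span R _ => g chi) a0).
  apply: clopen_span_ext => chi /=.
  by have := congr1 chi fa; rewrite characterM character_unit mul1r character0.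
- move=> g; have [n [c [U [cU gE]]]] := clopen_spanP g.
  have [e eP] := choice (fun i => clopen_spectrum (cU i)).
  exists (\sum_i c i *: e i); rewrite psiE; apply: clopen_span_ext => chi.
  rewrite gE fct_sumE /=.
  rewrite (big_morph (fun x => chi x) (characterD chi) (character0 chi)).
  by apply: eq_bigr => i _; rewrite characterZ eP.
Qed.

End Spectrum.

(** * Existence of characters *)

Section EnoughCharacters.
Variables (R : realType) (A : starAlgType R).
Hypotheses (bA : baer A) (alg : split_algebraic A).
Variables u f : A.
Hypotheses (pu : projection u) (u1 : forall x, u ** x = x).
Hypotheses (pf : projection f) (fC : central f).
Hypothesis fcomm : forall x y, f ** (x ** y) = f ** (y ** x).
Implicit Types (a b x y v w e g h p q t : A).

Let u2 := unit_projection u1 pu.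
Let proper := baer_proper bA.

(** The empty set is allowed as I, which keeps Zorn's lemma free of a special
    case for the empty chain. *)
Definition ideal_avoiding e (I : set A) :=
  [/\ forall x y, I x -> I y -> I (x + y),
      forall a x, I x -> I (a ** x), forall a x, I x -> I (x ** a) & ~ I e].

Lemma exists_maximal_ideal e : exists I : set A,
  ideal_avoiding e I /\ forall J, ideal_avoiding e J -> I `<=` J -> J = I.
Proof.
have [|I [PI maxI]] := @Zorn_bigcup A (ideal_avoiding e).
  move=> F FP Ftot; split.
  - move=> x y [I FI Ix] [J FJ Jy].
    have [IJ|JI] := Ftot _ _ FI FJ.
      by exists J => //; case: (FP _ FJ) => D _ _ _; apply: D => //; exact: IJ.
    by exists I => //; case: (FP _ FI) => D _ _ _; apply: D => //; exact: JI.
  - by move=> a x [I FI Ix]; exists I => //; case: (FP _ FI) => _ M _ _; exact: M.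
  - by move=> a x [I FI Ix]; exists I => //; case: (FP _ FI) => _ _ M _; exact: M.
  - by move=> [I FI Ie]; case: (FP _ FI).
exists I; split => // J PJ IJ; apply/seteqP; split => //; apply: contrapT => JI.
by apply: (maxI J) => //; split.
Qed.

(** Choose a maximal ideal I avoiding e. It is prime, because e is central,
    idempotent and e x y = e y x; and since
    (a - c_1) ... (a - c_m) = 0, some a - c lies in I. This c is the value of
    the character at a. *)
Lemma exists_character e : projection e -> e != 0 -> f ** e = e ->
  exists chi : spectrum f, chi e = 1.
Proof.
move=> pe e0 fe; have /projectionP[_ ee] := pe.
have eC : central e by move=> x; rewrite -{1}fe -smulA fcomm smulA fC -smulA fe.
have ecomm x y : e ** (x ** y) = e ** (y ** x).
  have ef : e ** f = e by rewrite eC.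
  by rewrite -ef -!smulA fcomm.
have ecomm3 v x y : e ** (v ** (x ** y)) = e ** (v ** (y ** x)).
  by rewrite !(smulA e v) eC -!smulA ecomm.
have eM x y : (e ** x) ** (e ** y) = e ** (x ** y).
  by rewrite -smulA (smulA x) -eC -smulA (smulA e) ee.
have [I [PI maxI]] := exists_maximal_ideal e; have [ID IMl IMr Ie] := PI.
have I0 : I 0.
  rewrite -(maxI [set x | x = 0 \/ I x]); [by left| |by move=> x; right].
  split.
  - move=> x y [->|Ix] [->|Iy]; rewrite ?addr0 ?add0r; [by left|by right..|].
    by right; exact: ID.
  - by move=> a x [->|Ix]; [left; rewrite smul0r|right; exact: IMl].
  - by move=> a x [->|Ix]; [left; rewrite smul0l|right; exact: IMr].
  - by move=> [/eqP|//]; rewrite (negbTE e0).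
have IeM x : I (e ** x) -> I x.
  move=> Iex; rewrite -(maxI [set x | I (e ** x)]) //; last by move=> y; exact: IMl.
  split => /=.
  - by move=> y z Iy Iz; rewrite smulDr; exact: ID.
  - by move=> a y Iy; rewrite ecomm smulA; exact: IMr.
  - by move=> a y Iy; rewrite smulA; exact: IMr.
  - by rewrite ee.
(* the ideal generated by I and b, up to multiplication by e, contains e *)
have maxE b : ~ I b -> exists i y, I i /\ e = i + e ** (y ** b).
  move=> nIb; apply: contrapT => ne.
  pose J := [set x | exists i y, I i /\ e ** x = i + e ** (y ** b)].
  have IJ : J = I.
    apply: maxI; last first.
      move=> x Ix; exists (e ** x), 0; rewrite smul0l smul0r addr0.
      by split=> //; exact: IMl.
    split.
    - move=> x y [i [v [Ii vE]]] [j [w [Ij wE]]]; exists (i + j), (v + w); split.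
        exact: ID.
      by rewrite smulDr vE wE smulDl smulDr addrACA.
    - move=> a x [i [v [Ii vE]]]; exists (i ** a), (v ** a); split; first exact: IMr.
      by rewrite ecomm smulA vE smulDl -!smulA ecomm3.
    - move=> a x [i [v [Ii vE]]]; exists (i ** a), (v ** a); split; first exact: IMr.
      by rewrite smulA vE smulDl -!smulA ecomm3.
    - by move=> [i [v [Ii vE]]]; apply: ne; exists i, v; rewrite -{1}ee.
  by apply: nIb; rewrite -IJ; exists 0, u; rewrite u1 add0r.
have prime x y : I (x ** y) -> I x \/ I y.
  move=> Ixy; have [|/maxE[i [a [Ii ea]]]] := pselect (I x); first by left.
  have [|/maxE[j [b [Ij eb]]]] := pselect (I y); first by right.
  have eij : e = (i + e ** (a ** x)) ** (j + e ** (b ** y)) by rewrite -ea -eb ee.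
  exfalso; apply: Ie; rewrite eij smulDr; apply: (ID); first exact: IMl.
  rewrite smulDl; apply: ID; first exact: IMr.
  apply: IeM.
  have -> : e ** (e ** (a ** x) ** (e ** (b ** y))) = e ** ((a ** b) ** (x ** y)).
    rewrite eM smulA ee -!smulA !(smulA e a) eC -!(smulA a e).
    by rewrite (smulA x) (smulA e) ecomm -!smulA.
  by apply: (IMl); exact: IMl.
have nIu : ~ I u by move=> Iu; apply: Ie; rewrite -(u2 e); exact: IMl.
have root a s z : I (roots_mul a s z) -> ~ I z -> exists c, I (a - c *: u).
  elim: s => [//|c s IH] /= Iaz nIz.
  have [|Ia|/IH] := prime (a - c *: u) (roots_mul a s z); last exact.
    by rewrite smulBl smulZl u1.
  by exists c.
have /choice[chi chiP] a : exists c, I (a - c *: u).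
  by have [s sz] := alg a; apply: (root a s u) => //; rewrite sz.
have IN x : I x -> I (- x).
  by move=> Ix; rewrite -(u1 x) -smulNl; exact: IMl.
have IZ (k : R[i]) x : I x -> I (k *: x).
  by move=> Ix; rewrite -(u1 x) -smulZl; exact: IMl.
have chiU a c : I (a - c *: u) -> chi a = c.
  move=> Ia; have : I ((c - chi a) *: u).
    have -> : (c - chi a) *: u = (a - chi a *: u) + - (a - c *: u).
      by rewrite scalerBl opprB [RHS]addrC addrA subrK.
    by apply: ID => //; exact: IN.
  move=> Iu; apply/eqP; rewrite eq_sym -subr_eq0; apply/negPn/negP => d0.
  by apply: nIu; rewrite -(scale1r u) -(mulVf d0) -scalerA; exact: IZ.
have lin (k : R[i]) x y : chi (k *: x + y) = k * chi x + chi y.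
  apply: chiU; rewrite scalerDl opprD addrACA -scalerA -scalerBr.
  by apply: ID; [apply: IZ|].
have mul x y : chi (x ** y) = chi x * chi y.
  apply: chiU.
  have -> : x ** y - (chi x * chi y) *: u =
      (x - chi x *: u) ** y + (chi x *: u) ** (y - chi y *: u).
    by rewrite smulBl !smulZl !u1 scalerBr scalerA addrA subrK.
  by apply: ID; [apply: IMr|apply: IMl].
have unf : chi f = 1.
  apply: chiU; apply: IeM; rewrite scale1r smulBr u2 -fC fe subrr.
  exact: I0.
exists (Character lin mul unf) => /=.
by apply: chiU; apply: IeM; rewrite scale1r smulBr u2 ee subrr.
Qed.

(** If f b is nonzero, an eigenprojection e of (f b)^* (f b) for a nonzero
    eigenvalue c lies below f, and a character with value 1 at e takes
    (f b)^* (f b) to c. *)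
Lemma characters_separate b : (forall chi : spectrum f, chi b = 0) -> f ** b = 0.
Proof.
move=> chib; apply/eqP/negPn/negP => fb0.
set h := star (f ** b) ** (f ** b).
have sh : star h = h by rewrite /h starM starK.
have h0 : h != 0 by apply: contra_neq fb0; exact: proper.
have [c [e [c0 _ pe e0 he]]] := self_adjoint_eigenprojection alg proper sh h0.
have fh : f ** h = h.
  case/projectionP: pf => sf ff.
  by rewrite /h smulA fC -smulA (smulA f) ff.
have fe : f ** e = e.
  by apply: (scalerI c0); rewrite -smulZr -he smulA fh.
have [chi chie] := exists_character pe e0 fe.
case/eqP: c0; have := congr1 chi he.
by rewrite characterM characterZ /h !characterM chib !mulr0 mul0r chie mulr1.
Qed.

End EnoughCharacters.

(** * Algebraic Baer algebras from the decomposition *)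

Section Transport.
Variable R : realType.
Implicit Types A B : starAlgType R.

Lemma baerI A : (forall S : set A, S !=set0 -> exists f, [/\ projection f,
    forall a, S a -> a ** f = 0 &
    forall y, (forall a, S a -> a ** y = 0) -> f ** y = y]) -> baer A.
Proof.
move=> bA S /bA[f [pf Sf f1]]; exists f; split => //.
apply/seteqP; split => [y Sy|_ [y _ <-] a Sa]; first by exists y => //; exact: f1.
by rewrite smulA Sf // smul0l.
Qed.

Lemma split_algebraic_iso A B : star_isomorphic A B ->
  split_algebraic B -> split_algebraic A.
Proof.
move=> [phi [phib phiM _]] algB a; have [s sz] := algB (phi a); exists s => b.
apply: (bij_inj phib); rewrite linear0 -(sz (phi b)).
by elim: s {sz} => //= c s <-; rewrite linearB linearZ /= phiM.
Qed.

Lemma baer_iso A B : star_isomorphic A B -> baer B -> baer A.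
Proof.
move=> [phi [[psi phiK psiK] phiM phiS]] bB; apply: baerI => S [a0 Sa0].
have psiM x y : psi (x ** y) = psi x ** psi y.
  by apply: (can_inj phiK); rewrite phiM !psiK.
have [|f [/projectionP[sf ff] Sf f1]] := @baer_ann _ _ bB (phi @` S).
  by exists (phi a0), a0.
exists (psi f); split.
- apply/projectionP; split; first by apply: (can_inj phiK); rewrite phiS psiK.
  by rewrite -psiM ff.
- move=> a Sa; apply: (can_inj phiK); rewrite phiM psiK linear0.
  by apply: Sf; exists a.
- move=> y Sy; apply: (can_inj phiK); rewrite phiM psiK; apply: f1 => _ [a Sa <-].
  by rewrite -phiM Sy ?linear0.
Qed.

Lemma split_algebraic_prod A B :
  split_algebraic A -> split_algebraic B -> split_algebraic (A * B)%type.
Proof.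
move=> algA algB [a b]; have [s sz] := algA a; have [t tz] := algB b.
exists (s ++ t) => -[x y].
have E r z w : roots_mul (a, b) r (z, w) = (roots_mul a r z, roots_mul b r w).
  by elim: r => //= c r ->.
by rewrite E roots_mul_cat sz roots_mul_cat tz roots_mul0.
Qed.

Lemma baer_prod A B : baer A -> baer B -> baer (A * B)%type.
Proof.
move=> bA bB; apply: baerI => S [c0 Sc0].
have [|f [/projectionP[sf ff] Sf f1]] := @baer_ann _ _ bA (fst @` S).
  by exists c0.1, c0.
have [|g [/projectionP[sg gg] Sg g1]] := @baer_ann _ _ bB (snd @` S).
  by exists c0.2, c0.
exists (f, g); split.
- by apply/projectionP; split; congr (_, _).
- by move=> a Sa; congr (_, _); [apply: Sf|apply: Sg]; exists a.
- move=> [y z] Sy; congr (_, _).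
    by apply: f1 => _ [a Sa <-]; exact: (congr1 fst (Sy a Sa)).
  by apply: g1 => _ [a Sa <-]; exact: (congr1 snd (Sy a Sa)).
Qed.

Lemma split_algebraic_dirsum k (F : 'I_k -> starAlgType R) :
  (forall i, split_algebraic (F i)) -> split_algebraic (dirsum F).
Proof.
move=> algF a; have /choice[s sz] i : exists s, forall b, roots_mul (a i) s b = 0.
  exact: algF.
exists (flatten [seq s i | i <- enum 'I_k]) => b.
have E r (c : dirsum F) i : roots_mul a r c i = roots_mul (a i) r (c i).
  by elim: r => //= d r <-.
apply: functional_extensionality_dep => i; rewrite E.
have : i \in enum 'I_k by rewrite mem_enum.
elim: (enum 'I_k) => //= j r IH; rewrite inE roots_mul_cat => /orP[/eqP <-|/IH ->].
  by rewrite sz.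
by rewrite roots_mul0.
Qed.

Lemma baer_dirsum k (F : 'I_k -> starAlgType R) :
  (forall i, baer (F i)) -> baer (dirsum F).
Proof.
move=> bF; apply: baerI => S [c0 Sc0].
have ev i : exists f, [/\ projection f, forall a, S a -> a i ** f = 0 &
    forall y, (forall a, S a -> a i ** y = 0) -> f ** y = y].
  have [|f [pf Sf f1]] := @baer_ann _ _ (bF i) ((fun a : dirsum F => a i) @` S).
    by exists (c0 i), c0.
  exists f; split => // [a Sa|y Sy]; first by apply: Sf; exists a.
  by apply: f1 => _ [a Sa <-]; exact: Sy.
pose f : dirsum F := fun i => projT1 (cid (ev i)).
have fP i := projT2 (cid (ev i)).
exists f; split.
- apply/projectionP; split; apply: functional_extensionality_dep => i.
    by case: (fP i) => /projectionP[].
  by case: (fP i) => /projectionP[].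
- move=> a Sa; apply: functional_extensionality_dep => i.
  by case: (fP i) => _ + _; exact.
- move=> y Sy; apply: functional_extensionality_dep => i.
  case: (fP i) => _ _; apply => a Sa.
  exact: (congr1 (fun z : dirsum F => z i) (Sy a Sa)).
Qed.

Lemma matrix_proper n (x : 'M[R[i]]_n) : star x ** x = 0 -> x = 0.
Proof.
move=> xx; apply/matrixP => k j; rewrite mxE.
have := congr1 (fun m : 'M[R[i]]_n => m j j) xx.
rewrite !mxE => /eqP; rewrite psumr_eq0 => [/allP/(_ k)|i _]; last first.
  by rewrite !mxE mulrC mulcJ_ge0.
rewrite mem_index_enum !mxE => /(_ isT)/implyP/(_ isT).
by rewrite mulf_eq0 conjc_eq0 orbb => /eqP.
Qed.

(** Let f be a projection of maximal rank in the annihilator. If f y <> y for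
    some y in it, put z = y - f y; an eigenprojection e of z z^* is orthogonal
    to f and lies in the annihilator, so f + e has larger rank. *)
Lemma matrix_baer n : baer ('M[R[i]]_n).
Proof.
apply: baerI => S [a0 Sa0].
pose P r := `[< exists f : 'M[R[i]]_n,
  [/\ projection f, forall a, S a -> a ** f = 0 & \rank f = r] >].
have P0 : exists r, P r.
  exists 0%N; apply/asboolP; exists 0; split; rewrite ?mxrank0 //.
    exact: projection0.
  by move=> a _; rewrite smul0r.
have Pb r : P r -> (r <= n)%N.
  by move=> /asboolP[f [_ _ <-]]; exact: rank_leq_row.
case: (ex_maxnP P0 Pb) => r /asboolP[f [pf Sf rf]] rmax.
exists f; split => // y Sy; apply/eqP; rewrite eq_sym -subr_eq0.
apply/negPn/negP => z0; set z := y - f ** y in z0.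
have /projectionP[sf ff] := pf.
have fz : f ** z = 0 by rewrite smulBr smulA ff subrr.
have Sz a : S a -> a ** z = 0.
  by move=> Sa; rewrite smulBr smulA Sf // smul0l subr0 Sy.
set h := z ** star z.
have sh : star h = h by rewrite /h starM starK.
have h0 : h != 0.
  apply: contra_neq z0 => h0; apply: star_eq0; apply: matrix_proper.
  by rewrite starK.
have [c [e [c0 _ pe e0 he]]] := self_adjoint_eigenprojection
  (@matrix_split_algebraic R n) (@matrix_proper n) sh h0.
have ann w : w ** z = 0 -> w ** e = 0.
  by move=> wz; apply: (scalerI c0); rewrite -smulZr -he /h !smulA wz !smul0l scaler0.
have fe := ann f fz.
have pfe := projectionD pf pe fe.
have ffe : f ** (f + e) = f by rewrite smulDr ff fe addr0.
have fle : (f <= (f + e)%R)%MS by apply/submxP; exists f; exact: esym ffe.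
have : (\rank (f + e)%R <= r)%N.
  apply: rmax; apply/asboolP; exists (f + e); split => // a Sa.
  by rewrite smulDr Sf // add0r; apply: ann; exact: Sz.
rewrite -rf (geq_leqif (mxrank_leqif_sup fle)) => /submxP[D fD].
case/eqP: e0; apply: (addrI f); rewrite addr0.
have : (f + e) ** f = f + e by rewrite {1}fD -[D *m f]/(D ** f) -smulA ff.
by move=> <-; case/projectionP: pfe => sfe _; rewrite -{2}sf -sfe -starM ffe.
Qed.

End Transport.

Section ClopenSpanBaer.
Variables (R : realType) (T : topologicalType).
Implicit Types g b : clopen_span R T.

(** The values of a combination of n indicators are among the 2^n partial sums
    of its coefficients. *)
Lemma clopen_span_split_algebraic : split_algebraic (clopen_span R T).
Proof.
move=> g; have [n [c [U [cU gE]]]] := clopen_spanP g.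
exists [seq \sum_(i in J) c i | J : {set 'I_n} <- enum {set 'I_n}] => b.
have E r t : roots_mul g r b t = \prod_(d <- r) (g t - d) * b t.
  elim: r => [|d r IH] /=; first by rewrite big_nil mul1r.
  by rewrite big_cons -mulrA mulrBl -IH.
apply: clopen_span_ext => t; rewrite E -[RHS]/(0 : R[i]).
apply/eqP; rewrite mulf_eq0 prodf_seq_eq0; apply/orP; left.
apply/hasP; exists (g t); last by rewrite /= subrr.
apply/mapP; exists [set i | t \in U i]%SET; first by rewrite mem_enum.
rewrite gE fct_sumE [RHS]big_mkcond /=; apply: eq_bigr => i _.
rewrite /GRing.scale /= indicE finset.in_set.
by case: (t \in U i); [exact: mulr1|exact: mulr0].
Qed.

(** Combinations of clopen indicators are locally constant. *)
Lemma open_clopen_span_preimage g (P : set R[i]) : open (g @^-1` P).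
Proof.
have [n [c [U [cU gE]]]] := clopen_spanP g.
rewrite openE => t Pt; rewrite /interior.
have : \forall s \near t, forall i, (s \in U i) = (t \in U i).
  apply: filter_forall => i; case: (cU i) => oU cUi.
  have [tU|tU] := boolP (t \in U i).
    apply: filterS (open_nbhs_nbhs (conj oU (set_mem tU))) => s sU.
    by rewrite mem_set.
  have tU' : (~` U i) t by move=> tUi; move/negP: tU; apply; rewrite inE.
  apply: filterS (open_nbhs_nbhs (conj (closed_openC cUi) tU')) => s sU.
  by rewrite memNset.
apply: filterS => s st; rewrite /preimage /=; suff -> : g s = g t by [].
by rewrite gE !fct_sumE; apply: eq_bigr => i _; rewrite /GRing.scale /= !indicE st.
Qed.

(** The annihilator of S consists of the y vanishing on the union U of the
    supports, hence on its closure, which is clopen. *)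
Lemma clopen_span_baer : (forall U : set T, open U -> open (closure U)) ->
  baer (clopen_span R T).
Proof.
move=> ext; apply: baerI => S _.
pose U := \bigcup_(a in S) [set t | (a : clopen_span R T) t != 0].
have oU : open U.
  apply: bigcup_open => a _.
  exact: (open_clopen_span_preimage a [set c | c != 0]).
have cV : clopen (~` closure U).
  split; first by apply: closed_openC; exact: closed_closure.
  by apply: open_closedC; exact: ext.
pose f : clopen_span R T := ClopenSpan (asboolT (clopen_span_indic R cV)).
have fE t : f t = \1_(~` closure U) t by [].
exists f; split.
- apply/projectionP; split; apply: clopen_span_ext => t.
    by rewrite -[LHS]/(conjc (f t)) fE indicE conjc_nat.
  by rewrite -[LHS]/(f t * f t) fE indicE -natrM mulnb andbb.
- move=> a Sa; apply: clopen_span_ext => t.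
  rewrite -[LHS]/(a t * f t) -[RHS]/(0 : R[i]).
  have [->|at0] := eqVneq (a t) 0; first by rewrite mul0r.
  rewrite fE indicE memNset ?mulr0 // => nU; apply: nU; apply: subset_closure.
  by exists a.
- move=> y Sy; apply: clopen_span_ext => t; rewrite -[LHS]/(f t * y t) fE indicE.
  have [cU|cU] := pselect (closure U t); last by rewrite mem_set ?mul1r.
  suff -> : y t = 0 by rewrite mulr0.
  have cZ : closed [set t | y t = 0].
    rewrite -[X in closed X]setCK; apply: open_closedC.
    exact: (open_clopen_span_preimage y [set c | c <> 0]).
  have UZ : U `<=` [set t | y t = 0].
    move=> s [a Sa as0]; have := congr1 (fun g : clopen_span R T => g s) (Sy a Sa).
    by move=> /eqP; rewrite -[_ == _]/(a s * y s == 0) mulf_eq0 (negbTE as0) => /eqP.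
  by have := closureS UZ cU; rewrite -(closure_id _).1.
Qed.

End ClopenSpanBaer.

Theorem theorem3p6 (R : realType) (A : starAlgType R) :
  (algebraic A /\ baer A) <->
  (exists M B : starAlgType R,
     [/\ star_isomorphic A (M * B)%type,
         exists (k : nat) (n : 'I_k -> nat),
           (forall i, (2 <= n i)%N) /\ star_isomorphic M (matrix_sum R n) &
         exists T : topologicalType,
           stonean T /\ star_isomorphic B (clopen_span R T)]).
Proof.
have star_isomorphic_refl (C : starAlgType R) : star_isomorphic C C.
  by exists idfun; split => //; exists idfun.
split=> [[/algebraic_split alg bA]|[M [B [iA [k [n [_ iM]]] [T [[_ _ ext] iB]]]]]].
  have [u pu u1] := baer_unit bA; have u2 := unit_projection u1 pu.
  have [f [pf fC fcomm fmax]] := abelian_summand bA u1.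
  have ptf : projection (u - f) by apply: projectionB.
  have tfC : central (u - f) by move=> x; rewrite smulBl smulBr u1 u2 fC.
  have tff : (u - f) ** f = 0.
    by rewrite smulBl u1; case/projectionP: pf => _ ->; rewrite subrr.
  have [|k [n [n2 qM]]] := noncommutative_quotient bA alg pu u1 ptf tfC.
    move=> h ph hC th hcomm; have fh := fmax h ph hC hcomm.
    by rewrite -th -fh smulA tff smul0l.
  have sep := characters_separate bA alg pu u1 pf fC fcomm.
  have qB := spectrum_quotient bA alg fC sep.
  exists (matrix_sum R n), (clopen_span R (spectrum f)); split.
  - apply: (star_quotient_iso u1).
    by have := star_quotientD ptf pf tff qM qB; rewrite subrK.
  - by exists k, n; split.
  - by exists (spectrum f); split => //; exact: spectrum_stonean.
split.
  apply/split_algebraicW/(split_algebraic_iso iA)/split_algebraic_prod.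
    apply/(split_algebraic_iso iM)/split_algebraic_dirsum => i.
    exact: matrix_split_algebraic.
  exact/(split_algebraic_iso iB)/clopen_span_split_algebraic.
apply/(baer_iso iA)/baer_prod.
  by apply/(baer_iso iM)/baer_dirsum => i; exact: matrix_baer.
exact/(baer_iso iB)/clopen_span_baer.
Qed.
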